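(* The decomposition of a real Bott manifold into a product of indecomposable real Bott manifolds is unique up to permutations of the indecomposable factors. Namely, if $\prod_{i=1}^k M_i$ is diffeomorphic to $\prod_{j=1}^\ell N_j$, where all $M_i$ and $N_j$ are indecomposable real Bott manifolds, then $k=\ell$ and there is a permutation $\sigma$ of $\{1,\dots,k\}$ such that $M_i$ is diffeomorphic to $N_{\sigma(i)}$ for $i=1,\dots,k$.
   Context: A real Bott manifold of dimension $n$ is the total space $M_n$ of a sequence of $\mathbb{R}P^1$-bundles $M_n\to M_{n-1}\to\cdots\to M_1\to M_0=\{\text{a point}\}$ such that, for each $j=1,\dots,n$, $M_j\to M_{j-1}$ is the projective bundle of the Whitney sum of a real line bundle $L_{j-1}$ and the trivial real line bundle over $M_{j-1}$. Equivalently (up to diffeomorphism), it is $M(A)=(S^1)^n/G(A)$ for an $n\times n$ upper triangular matrix $A=(A^i_j)$ over $\mathbb{Z}/2=\{0,1\}$ with zero diagonal, where $G(A)$ is generated by the commuting involutions $a_i(z_1,\dots,z_n)=(z_1,\dots,z_{i-1},-z_i,z_{i+1}(A^i_{i+1}),\dots,z_n(A^i_n))$, with $z(0)=z$ and $z(1)=\bar z$ for $z\in S^1\subset\mathbb{C}$. A real Bott manifold (of positive dimension) is indecomposable if it is not diffeomorphic to a product of more than one real Bott manifolds of positive dimension. *)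

(* Defs.v *)
From HB Require Import structures.
From mathcomp Require Import all_boot all_order all_algebra all_fingroup.
From mathcomp Require Import all_classical all_reals all_analysis.
From mathcomp Require Import complex.
Set Implicit Arguments.
Unset Strict Implicit.
Unset Printing Implicit Defensive.
Import Order.TTheory GRing.Theory Num.Theory numFieldNormedType.Exports.
Local Open Scope classical_set_scope.
Local Open Scope ring_scope.

Fixpoint Ck_on (R : realType) (n m k : nat) (U : set 'rV[R]_n)
    (f : 'rV[R]_n -> 'rV[R]_m) : Prop :=
  (forall x, U x -> {for x, continuous f}) /\
  if k is k'.+1 then
    forall i : 'I_n,
      (forall x, U x -> derivable f x (delta_mx 0 i)) /\
      Ck_on k' U (fun x => 'D_(delta_mx 0 i) f x)
  else True.

(* Meant for open [U]: continuity and derivatives in [Ck_on] are those of [f]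
   as a function on the whole space. *)
Definition smooth_on (R : realType) (n m : nat) (U : set 'rV[R]_n)
    (f : 'rV[R]_n -> 'rV[R]_m) : Prop :=
  forall k, Ck_on k U f.

(* An atlas is given by local parametrizations (inverse charts): a pair
   [(U, phi)] stands for the map [phi] restricted to [U]; the values of [phi]
   outside [U] are irrelevant.  The conditions making this a manifold are
   collected in [smooth_manifold] below. *)
Record atlas_space (R : realType) := AtlasSpace {
  carrier :> Type;
  dim : nat;
  atlas : set (set 'rV[R]_dim * ('rV[R]_dim -> carrier))
}.
Arguments dim {R} _.
Arguments atlas {R} _.

(* [f] is smooth in local coordinates: wherever [f \o phi] meets the image of a
   parametrization [psi] of [Y], it is locally of the form [psi \o g] with [g]
   smooth. *)
Definition smooth_map (R : realType) (X Y : atlas_space R) (f : X -> Y) : Prop :=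
  forall c d x, atlas X c -> atlas Y d -> c.1 x ->
    (d.2 @` d.1) (f (c.2 x)) ->
    exists (W : set 'rV[R]_(dim X)) (g : 'rV[R]_(dim X) -> 'rV[R]_(dim Y)),
      [/\ open W, W x, W `<=` c.1, smooth_on W g &
          forall w, W w -> d.1 (g w) /\ f (c.2 w) = d.2 (g w)].

Definition diffeomorphic (R : realType) (X Y : atlas_space R) : Prop :=
  exists (f : X -> Y) (g : Y -> X),
    [/\ cancel f g, cancel g f, smooth_map f & smooth_map g].

Definition atlas_open (R : realType) (X : atlas_space R) (O : set X) : Prop :=
  forall c, atlas X c -> open (c.1 `&` c.2 @^-1` O).

(* The fourth clause says that the transition maps are defined on open sets and
   smooth; the last one is second countability, for a locally Euclidean space. *)
Definition smooth_manifold (R : realType) (X : atlas_space R) : Prop :=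
  [/\ forall c, atlas X c -> open c.1,
      forall c, atlas X c -> {in c.1 &, injective c.2},
      forall p : X, exists2 c, atlas X c & (c.2 @` c.1) p,
      smooth_map (@id X) &
      (forall p q : X, p <> q -> exists O1 O2 : set X,
         [/\ atlas_open O1, atlas_open O2, O1 p, O2 q & O1 `&` O2 = set0]) /\
      (exists2 D, D `<=` atlas X &
         countable D /\ forall p : X, exists2 c, D c & (c.2 @` c.1) p)].

(* [submxrow x i] is the [i]-th block of [x] in the decomposition of
   'rV_(\sum_i dim (M i)). *)
Definition prod_space (R : realType) (k : nat) (M : 'I_k -> atlas_space R) :
    atlas_space R :=
  @AtlasSpace R (forall i, M i) (\sum_(i < k) dim (M i))%N
    [set c | exists2 d : forall i,
         set 'rV[R]_(dim (M i)) * ('rV[R]_(dim (M i)) -> M i),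
       (forall i, atlas (M i) (d i)) &
       c = ([set x | forall i, (d i).1 (submxrow x i)],
            fun x i => (d i).2 (submxrow x i))].

Definition torus (R : realType) (n : nat) : set ('I_n -> R[i]) :=
  [set z | forall j, `|z j| = 1].

Definition bott_matrix (n : nat) (A : 'M['F_2]_n) : Prop :=
  forall i j : 'I_n, (j <= i)%N -> A i j = 0.

(* z(0) = z and z(1) = conjugate of z. *)
Definition twist (R : realType) (z : R[i]) (a : 'F_2) : R[i] :=
  if a == 0 then z else z^*.

Definition bott_involution (R : realType) (n : nat) (A : 'M['F_2]_n) (i : 'I_n)
    (z : 'I_n -> R[i]) : 'I_n -> R[i] :=
  fun j => if (j < i)%N then z j
           else if j == i then - z j
           else twist (z j) (A i j).

(* The generators are involutions, so every element of the group G(A) they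
   generate is a product of generators. *)
Definition bott_orbit (R : realType) (n : nat) (A : 'M['F_2]_n)
    (z : 'I_n -> R[i]) : set ('I_n -> R[i]) :=
  [set w | exists s : seq 'I_n, w = foldr (bott_involution A) z s].

Definition bott_quotient (R : realType) (n : nat) (A : 'M['F_2]_n) : Type :=
  {C : set ('I_n -> R[i]) | exists2 z, torus z & C = bott_orbit A z}.

Definition circle_exp (R : realType) (n : nat) (t : 'rV[R]_n) : 'I_n -> R[i] :=
  fun j => (cos (t 0 j) +i* sin (t 0 j))%C.

Lemma circle_exp_torus (R : realType) (n : nat) (t : 'rV[R]_n) :
  torus (circle_exp t).
Proof.
by move=> j; rewrite /circle_exp normc_def /= cos2Dsin2 sqrtr1.
Qed.

Definition bott_proj (R : realType) (n : nat) (A : 'M['F_2]_n) (t : 'rV[R]_n) :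
    bott_quotient R A :=
  exist _ (bott_orbit A (circle_exp t))
    (ex_intro2 _ _ (circle_exp t) (circle_exp_torus t) erefl).

(* M(A) = (S^1)^n / G(A) with the smooth structure for which
   R^n -> (S^1)^n -> M(A) is a local diffeomorphism. *)
Definition bott_space (R : realType) (n : nat) (A : 'M['F_2]_n) :
    atlas_space R :=
  @AtlasSpace R (bott_quotient R A) n
    [set c | [/\ open c.1, {in c.1 &, injective (bott_proj A)} &
                 c.2 = bott_proj A]].

(* A real Bott manifold of dimension [dim X]. *)
Definition real_bott_manifold (R : realType) (X : atlas_space R) : Prop :=
  smooth_manifold X /\
  exists2 A : 'M['F_2]_(dim X), bott_matrix A & diffeomorphic X (bott_space R A).

Definition indecomposable (R : realType) (X : atlas_space R) : Prop :=
  [/\ real_bott_manifold X, (0 < dim X)%N &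
      ~ exists (k : nat) (N : 'I_k -> atlas_space R),
          [/\ (1 < k)%N,
              forall i, real_bott_manifold (N i) /\ (0 < dim (N i))%N &
              diffeomorphic X (prod_space N)]].

(* Main.v *)
From HB Require Import structures.
Require Import Defs.
From mathcomp Require Import all_boot all_order all_algebra all_fingroup.
From mathcomp Require Import all_classical all_reals all_analysis.
From mathcomp Require Import complex zify ring lra.
Set Implicit Arguments.
Unset Strict Implicit.
Unset Printing Implicit Defensive.
Import Order.TTheory GRing.Theory Num.Theory numFieldNormedType.Exports.
Local Open Scope classical_set_scope.
Local Open Scope ring_scope.

(** [M(A)] is the quotient of [R^n] by the group of maps
    [t |-> chi_v t + pi v], [v] in [Z^n], where [chi_v] is the diagonal sign
    matrix with entries [(-1)^((v A)_j)].  A diffeomorphism [M(A) -> M(B)] lifts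
    to [R^n] and induces an isomorphism of these groups.  Its reduction mod 2 is
    an isomorphism between the first cohomology groups over [F_2], with bases
    [x_1, ..., x_n], which respects the subspaces [E(a) + <a>], where [E(a)] is
    spanned by the [x_k] such that the [k]-th column [alpha_k] of [A] is [a]
    (these are the solutions of [x^2 = a x]).  Conversely such an isomorphism
    is realized by an affine map of [R^n], because invertible matrices over
    [F_2] lift to invertible integer matrices.

    So the theorem is about these data.  A decomposition of [M(A)] amounts to
    an idempotent fixing or killing each [x_k] and [alpha_k] with [alpha_k] not
    zero and preserving [E(0)].  Off circle factors the [x_k] and [alpha_k] with
    [alpha_k] not zero span, and on their span the idempotents of two
    decompositions commute; hence the summands other than circles agree as
    subspaces, and the circles are counted by the dimension. *)

(** * Linear algebra over the field with two elements *)

(** The shape of E(a) + <a> comes from affine maps. A linear map intertwines the sign matrices of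
    two deck groups when its nonzero entries join coordinates carrying the same character. This
    accounts for E(a), and it is why integer lifts must respect labels. Translating by pi/2 a
    coordinate with character a adds a to its class, which accounts for <a>.

    The obstacle is the circles. The x_k of a circle can be changed by adding any other x_l with
    alpha_l = 0, so a circle need not be a canonical subspace and only the number of circles can be
    compared. An irreducible block of size at least two is rigid because a functional on it is
    determined by its values on the x_k and alpha_k with alpha_k not zero, all of which an
    admissible idempotent merely scales.

    The invariant uses only the action of the deck group, so the smoothness of a diffeomorphism
    enters only through the continuity of its lifts. *)

Lemma F2_cases (x : 'F_2) : x = 0 \/ x = 1.
Proof. by case: x => [[|[|m]] lm]; [left|right|]; try apply: val_inj. Qed.

Lemma F2_neq0 (x : 'F_2) : x != 0 -> x = 1.
Proof. by case: (F2_cases x) => ->; rewrite ?eqxx. Qed.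

Lemma F2_natK (x : 'F_2) : ((x : nat)%:Z)%:~R = x :> 'F_2.
Proof. by case: (F2_cases x) => ->. Qed.

Lemma F2_nat_neq0 (x : 'F_2) : ((x : nat)%:Z != 0) = (x != 0).
Proof. by case: (F2_cases x) => ->. Qed.

(* Gaussian elimination: transvections and transpositions lift to integer
   matrices, and a pivot can only be used between positions of equal label. *)
Lemma unimodular_lift (T : eqType) (n : nat) (b a : 'I_n -> T)
    (Q : 'M['F_2]_n) :
  Q \in unitmx -> (forall j k, Q j k != 0 -> b j = a k) ->
  exists P : 'M[int]_n,
    [/\ P \in unitmx, forall j k, P j k != 0 -> b j = a k
      & map_mx intr P = Q :> 'M['F_2]_n].
Proof.
elim: n b a Q => [|n IH] b a Q Qu Qs.
  exists 1%:M; split; first exact: unitmx1.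
    by move=> [].
  by apply/matrixP => -[].
have [i0 Qi0] : exists i, Q i 0 != 0.
  apply/existsP; rewrite -[X in is_true X]negbK negb_exists; apply/negP => /forallP Q0.
  move: Qu; rewrite unitmxE (expand_det_col _ 0) big1 ?unitr0 // => i _.
  by have := Q0 i; rewrite negbK => /eqP ->; rewrite mul0r.
pose s := tperm 0 i0.
pose Q1 : 'M['F_2]_(1 + n) := row_perm s Q.
pose u := ursubmx Q1; pose v := dlsubmx Q1.
have Q100 : Q1 0 0 = 1 by rewrite mxE tpermL (F2_neq0 Qi0).
have Q1s j k : Q1 j k != 0 -> b (s j) = a k by rewrite mxE; exact: Qs.
have b0a0 : b (s 0) = a 0 by apply: Q1s; rewrite Q100.
have ul : ulsubmx Q1 = 1%:M.
  by apply/matrixP => i j; rewrite !ord1 !mxE !lshift0 tpermL (F2_neq0 Qi0).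
(* Schur complement of the pivot. An entry of [v *m u] can be nonzero only between positions that
   both share the label of the pivot, so [M] still respects the labels. *)
pose M := drsubmx Q1 - v *m u.
have QE : Q1 = block_mx 1%:M 0 v 1%:M *m block_mx 1%:M u 0 M.
  rewrite mulmx_block !mul1mx !mulmx1 !mulmx0 !mul0mx addr0 -[LHS]submxK ul.
  by rewrite /M addrCA subrr !addr0.
have Mu : M \in unitmx.
  have : Q1 \in unitmx by rewrite /Q1 row_permE unitmx_mul unitmx_perm.
  by rewrite QE unitmx_mul; rewrite [X in _ && X]unitmxE det_ublock det1 mul1r
    -unitmxE => /andP[].
have us k : u 0 k != 0 -> a 0 = a (rshift 1 k).
  by rewrite mxE mxE => /Q1s <-; rewrite lshift0 b0a0.
have vs j : v j 0 != 0 -> b (s (rshift 1 j)) = a 0.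
  by rewrite mxE mxE => /Q1s ->; rewrite lshift0.
have [|PM [PMu PMs PME]] := IH (fun j => b (s (rshift 1 j))) (fun k => a (rshift 1 k)) M Mu.
  move=> j k; rewrite mxE => Mjk.
  have [e|] := eqVneq (drsubmx Q1 j k) 0; last by rewrite mxE mxE => /Q1s.
  move: Mjk; rewrite e add0r mxE oppr_eq0 mxE big_ord1 mulf_eq0 negb_or.
  by move=> /andP[/vs /= -> /us].
pose lft m p (N : 'M['F_2]_(m, p)) := map_mx (fun x : 'F_2 => (x : nat)%:Z) N.
have lftK m p (N : 'M['F_2]_(m, p)) :
    map_mx intr (lft m p N) = N :> 'M['F_2]_(m, p).
  by apply/matrixP => i j; rewrite !mxE F2_natK.
pose P1 : 'M[int]_(1 + n) := block_mx 1%:M 0 (lft _ _ v) 1%:M *m block_mx 1%:M (lft _ _ u) 0 PM.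
have P1E : P1 = block_mx 1%:M (lft _ _ u) (lft _ _ v) (lft _ _ v *m lft _ _ u + PM).
  by rewrite /P1 mulmx_block !mul1mx !mulmx1 !mulmx0 !mul0mx !addr0.
exists (row_perm s P1); split.
- rewrite row_permE unitmx_mul unitmx_perm /=.
  suff : P1 \in unitmx by [].
  rewrite unitmx_mul !unitmxE det_lblock det_ublock !det1 !mul1r unitr1 /=.
  by rewrite -unitmxE.
- suff H j k : P1 j k != 0 -> b (s j) = a k.
    by move=> j k; rewrite mxE => /H; rewrite tpermK.
  rewrite P1E; case: (@split_ordP 1 n j) => j' ->; case: (@split_ordP 1 n k) => k' ->;
    rewrite ?ord1 ?lshift0.
  + by rewrite b0a0.
  + by rewrite -lshift0 block_mxEur mxE F2_nat_neq0 lshift0 b0a0 => /us.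
  + by rewrite -lshift0 block_mxEdl mxE F2_nat_neq0 lshift0 => /vs.
  + rewrite block_mxEdr mxE.
    have [e|/PMs //] := eqVneq (PM j' k') 0.
    rewrite e addr0 mxE big_ord1 !mxE mulf_eq0 negb_or !F2_nat_neq0.
    by move=> /andP[vj uk]; rewrite (vs j') ?(us k') ?mxE.
- have E : map_mx intr P1 = Q1 :> 'M['F_2]_(1 + n).
    by rewrite /P1 map_mxM !map_block_mx !lftK !map_mx1 !map_mx0 PME -QE.
  apply/matrixP => i j; have := congr1 (fun N : 'M['F_2]_(1 + n) => N (s i) j) E.
  by rewrite /= mxE [RHS]mxE tpermK => <-; rewrite mxE mxE.
Qed.

(* The class [alpha_k] with [x_k^2 = alpha_k x_k] in the cohomology ring. *)
Definition chr n (A : 'M['F_2]_n) (k : 'I_n) : 'rV['F_2]_n := \row_i A i k.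

(* [y] lies in [E(a) + <a>]: [y - e a] is supported on the [x_k] of class [a]. *)
Definition eigen n (A : 'M['F_2]_n) (a y : 'rV['F_2]_n) : Prop :=
  exists e : 'F_2, forall k, chr A k != a -> y 0 k = e * a 0 k.

(** Row vectors are cohomology classes, and [Y] sends the classes of [B] to those of [A]. The
    condition in this one direction suffices to build a diffeomorphism; transporting idempotents
    takes it in both, as in [eigen_iso]. *)
Definition eigen_iso1 n m (A : 'M['F_2]_n) (B : 'M['F_2]_m) : Prop :=
  exists (Y : 'M['F_2]_(m, n)) (Z : 'M['F_2]_(n, m)),
    [/\ Y *m Z = 1%:M, Z *m Y = 1%:M
      & forall j, eigen A (chr B j *m Y) (row j Y)].

Definition eigen_iso n m (A : 'M['F_2]_n) (B : 'M['F_2]_m) : Prop :=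
  exists (Y : 'M['F_2]_(m, n)) (Z : 'M['F_2]_(n, m)),
    [/\ Y *m Z = 1%:M, Z *m Y = 1%:M,
        forall j, eigen A (chr B j *m Y) (row j Y)
      & forall k, eigen B (chr A k *m Z) (row k Z)].

(** The scalar [c] is shared by x_k and alpha_k because both belong to the same factor. The second
    clause says that E(0) is preserved. *)
Definition admissible n (A p : 'M['F_2]_n) : Prop :=
  (forall k, chr A k != 0 -> exists c : 'F_2,
     row k p = c *: row k 1%:M /\ chr A k *m p = c *: chr A k) /\
  (forall k l, chr A k = 0 -> chr A l != 0 -> p k l = 0).

Definition irreducible n (A : 'M['F_2]_n) : Prop :=
  forall p, p *m p = p -> admissible A p -> p = 0 \/ p = 1%:M.

Lemma row_neq0 n (v : 'rV['F_2]_n) : v != 0 -> exists i, v 0 i != 0.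
Proof.
move=> v0; apply/existsP; apply: contraR v0; rewrite negb_exists => /forallP H.
by apply/eqP/rowP => i; rewrite mxE; apply/eqP; rewrite -[_ == _]negbK.
Qed.

Lemma mulmx_chr_eq0 n m (A : 'M['F_2]_n) (Y : 'M['F_2]_(m, n)) (Z : 'M['F_2]_(n, m)) k :
  Z *m Y = 1%:M -> (chr A k *m Z == 0) = (chr A k == 0).
Proof.
move=> ZY; apply/eqP/eqP => [E|->]; last by rewrite mul0mx.
by rewrite -[chr A k]mulmx1 -ZY mulmxA E mul0mx.
Qed.

(** The idempotent is the projection of [B] onto a union [c] of blocks, carried over to [A]. For
    alpha_k not zero put b = alpha_k Z. Some column of [B] equals b: otherwise row k of [Z] would be
    a multiple of b, hence x_k a multiple of alpha_k, against the zero diagonal. So b lies on one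
    side of [c], as do all coordinates of class b, and the projection scales both b and row k of [Z]
    by the same scalar. *)
Lemma admissible_transport n m (A : 'M['F_2]_n) (B : 'M['F_2]_m)
    (Y : 'M['F_2]_(m, n)) (Z : 'M['F_2]_(n, m)) (c : pred 'I_m) :
  bott_matrix A -> Z *m Y = 1%:M ->
  (forall j, eigen A (chr B j *m Y) (row j Y)) ->
  (forall k, eigen B (chr A k *m Z) (row k Z)) ->
  (forall i j, B i j != 0 -> c i = c j) ->
  admissible A (Z *m diag_mx (\row_i (c i)%:R) *m Y).
Proof.
move=> bA ZY hY hZ hc; set d := \row_i _.
have dE (v : 'rV['F_2]_m) c0 : (forall i, v 0 i != 0 -> c i = c0) ->
    v *m diag_mx d = c0%:R *: v.
  move=> hv; apply/rowP => i; rewrite mul_mx_diag !mxE.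
  by have [->|/hv ->] := eqVneq (v 0 i) 0; rewrite ?mulr0 ?mul0r // mulrC.
split=> [k Ak0|k l Ak0 Al0].
- set b := chr A k *m Z; have [e he] := hZ k; rewrite -/b in he.
  have b0 : b != 0 by rewrite (mulmx_chr_eq0 _ _ ZY).
  have [l /eqP Bl] : exists l, chr B l == b.
    apply/existsP; apply: contraT; rewrite negb_exists => /forallP H.
    have E : row k Z = e *: b by apply/rowP => l; rewrite he ?mxE.
    have : row k (Z *m Y) = e *: chr A k by rewrite row_mul E -scalemxAl -mulmxA ZY mulmx1.
    by move/rowP/(_ k); rewrite ZY !mxE eqxx bA // mulr0 => /eqP; rewrite oner_eq0.
  have bs i : b 0 i != 0 -> c i = c l by rewrite -Bl mxE; exact: hc.
  exists (c l)%:R; split.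
    rewrite -mulmxA row_mul mulmxA (dE _ (c l)); last first.
      move=> i; have [E _|/he ->] := eqVneq (chr B i) b.
        have [j bj] := row_neq0 b0.
        by rewrite -(bs j) //; apply/esym/hc; move: bj; rewrite -E mxE.
      by rewrite mulf_eq0 negb_or => /andP[_ /bs].
    by rewrite -scalemxAl -row_mul ZY.
  rewrite !mulmxA -/b (dE _ (c l)) // -scalemxAl /b -mulmxA ZY mulmx1 //.
- rewrite mxE big1 // => i _; rewrite mul_mx_diag !mxE.
  have [->|Zki] := eqVneq (Z k i) 0; first by rewrite !mul0r.
  have Bi0 : chr B i = 0.
    have [e he] := hZ k; apply/eqP; apply: contraNT Zki => Bi.
    by have := he i; rewrite Ak0 mul0mx => /(_ Bi); rewrite !mxE mulr0 => ->.
  have [e he] := hY i.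
  by have := he l; rewrite Bi0 mul0mx => /(_ Al0); rewrite !mxE mulr0 => ->; rewrite mulr0.
Qed.

(* Off dimension 1, the characters and the coordinates carrying a nonzero
   character span: otherwise a functional [lam] vanishing on them gives the
   rank one admissible idempotent [v |-> (v . lam) x_k]. *)
Lemma irreducible_span n (A : 'M['F_2]_n) (lam : 'cV['F_2]_n) :
  irreducible A -> n != 1%N ->
  (forall k, chr A k != 0 -> lam k 0 = 0 /\ chr A k *m lam = 0) -> lam = 0.
Proof.
move=> irr n1 hl; apply/eqP; apply: contraNT n1 => lam0.
have [k lk] : exists k, lam k 0 != 0.
  have [|k] := @row_neq0 _ lam^T; last by rewrite mxE; exists k.
  by apply: contra lam0 => /eqP E; rewrite -[lam]trmxK E trmx0.
have lk1 := F2_neq0 lk.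
have Ak0 : chr A k = 0.
  by apply/eqP; apply: contraNT lk => /hl[-> _].
pose p := lam *m row k 1%:M.
have pE i j : p i j = lam i 0 * (k == j)%:R by rewrite mxE big_ord1 !mxE.
have [||p0|p1] := irr p.
- rewrite /p mulmxA -[lam *m _ *m lam]mulmxA (_ : row k 1%:M *m lam = 1%:M) ?mulmx1 //.
  by apply/matrixP => i j; rewrite -row_mul mul1mx !ord1 !mxE.
- split=> [j /hl[lj Aj]|j l Aj Al].
    exists 0; rewrite !scale0r; split; last by rewrite mulmxA Aj mul0mx.
    by rewrite row_mul (_ : row j lam = 0) ?mul0mx //; apply/rowP => i; rewrite !mxE ord1.
  by rewrite pE; case: eqP => [E|]; rewrite ?mulr0 //; rewrite -E Ak0 eqxx in Al.
- by have := pE k k; rewrite p0 !mxE lk1 eqxx mul1r => /esym/eqP; rewrite oner_eq0.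
- have H j : j = k.
    apply/eqP; apply: contraT => jk; have := pE j j.
    by rewrite p1 !mxE eqxx eq_sym (negPf jk) mulr0 => /eqP; rewrite oner_eq0.
  by rewrite -(card_ord n) -(card1 k); apply/eqP/eq_card => j; rewrite !inE (H j) eqxx.
Qed.

(** * Block-diagonal matrices *)

Section Blocks.
Import tagnat.
Context {k : nat} {n_ : 'I_k -> nat} (A_ : forall i, 'M['F_2]_(n_ i)).
Let A := \mxdiag_i A_ i.

Lemma mxdiag_Rank i (a b : 'I_(n_ i)) : A (Rank _ a) (Rank _ b) = A_ i a b.
Proof.
by have := congr1 (fun N : 'M['F_2]_(n_ i) => N a b) (submxblock_diag A_ i); rewrite !mxE.
Qed.

Lemma mxdiag_neq0 a b : A a b != 0 -> sig1 a = sig1 b.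
Proof. by rewrite mxE; case: (sig1 a =P sig1 b) => // _; rewrite mxE eqxx. Qed.

Lemma bott_mxdiag : (forall i, bott_matrix (A_ i)) -> bott_matrix A.
Proof.
move=> bA a b ba; have [ab|] := eqVneq (sig1 a) (sig1 b); last first.
  by move=> ab; apply/eqP; apply: contraNT ab => /mxdiag_neq0 ->.
move: ba; rewrite -(sig2K a) -(sig2K b); move: (sig2 a) (sig2 b).
rewrite ab => i j; rewrite mxdiag_Rank => ji; apply: bA; move: ji.
by rewrite !RankEsum leq_add2l.
Qed.

(** [conform_mx] acts as a cast between rows of length [n_ i] and [n_ j], whose types coincide only
    after rewriting with [j == i]. *)
Lemma chr_mxdiag_submx i (a : 'I_(n_ i)) j :
  submxrow (chr A (Rank _ a)) j = if j == i then conform_mx 0 (chr (A_ i) a) else 0.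
Proof.
apply/rowP => b; rewrite mxE [LHS]mxE.
case: (eqVneq j i) b => [-> b|ji b]; first by rewrite conform_mx_id [RHS]mxE mxdiag_Rank.
rewrite [RHS]mxE; apply/eqP; apply: contraNT ji => /mxdiag_neq0.
by rewrite !Rank1K => ->.
Qed.

Lemma chr_mxdiag_eq0 i (a : 'I_(n_ i)) : (chr A (Rank _ a) == 0) = (chr (A_ i) a == 0).
Proof.
apply/eqP/eqP => [E|E].
  by have := chr_mxdiag_submx a i; rewrite E eqxx conform_mx_id submxrow0.
rewrite -[chr _ _]submxrowK; rewrite -[RHS]submxrowK; apply/eq_mxrow => j.
rewrite chr_mxdiag_submx submxrow0; case: eqP => // ->.
by rewrite conform_mx_id E.
Qed.

End Blocks.

Lemma submxblock_mul (F : pzSemiRingType) (p q r : nat) (p_ : 'I_p -> nat)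
    (q_ : 'I_q -> nat) (r_ : 'I_r -> nat)
    (X : 'M[F]_(\sum_i p_ i, \sum_i q_ i)) (X' : 'M[F]_(\sum_i q_ i, \sum_i r_ i)) i k :
  submxblock (X *m X') i k = \sum_j submxblock X i j *m submxblock X' j k.
Proof. by rewrite -{1}[X]submxblockK -{1}[X']submxblockK mul_mxblock mxblockK. Qed.

Lemma submxrow_mul (F : pzSemiRingType) (m q r : nat)
    (q_ : 'I_q -> nat) (r_ : 'I_r -> nat)
    (v : 'M[F]_(m, \sum_i q_ i)) (X : 'M[F]_(\sum_i q_ i, \sum_i r_ i)) k :
  submxrow (v *m X) k = \sum_j submxrow v j *m submxblock X j k.
Proof. by rewrite -{1}[v]submxrowK -{1}[X]submxblockK mul_mxrow_mxblock mxrowK. Qed.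

Lemma mulmx_submx (F : pzSemiRingType) (m n q : nat) (q_ : 'I_q -> nat)
    (v : 'M[F]_(m, \sum_i q_ i)) (w : 'M[F]_(\sum_i q_ i, n)) :
  v *m w = \sum_i submxrow v i *m submxcol w i.
Proof. by rewrite -{1}[v]submxrowK -{1}[w]submxcolK mul_mxrow_mxcol. Qed.

Lemma submxblock1 (F : pzSemiRingType) (p : nat) (p_ : 'I_p -> nat) i :
  submxblock (1%:M : 'M[F]_(\sum_i p_ i)) i i = 1%:M.
Proof. by rewrite -mxdiagZ submxblock_diag. Qed.

(** * Comparison of two block decompositions *)

Section Support.
Import tagnat.
Context {k : nat} {n_ : 'I_k -> nat} (A_ : forall i, 'M['F_2]_(n_ i)).
Let A := \mxdiag_i A_ i.
Context {l m : nat} (B : 'M['F_2]_m) (s : 'I_m -> 'I_l).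
Variables (Y : 'M['F_2]_(m, \sum_i n_ i)) (Z : 'M['F_2]_(\sum_i n_ i, m)).
Hypotheses (bA : forall i, bott_matrix (A_ i)) (ZY : Z *m Y = 1%:M).
Hypothesis YZ : Y *m Z = 1%:M.
Hypothesis hY : forall j, eigen A (chr B j *m Y) (row j Y).
Hypothesis hZ : forall k, eigen B (chr A k *m Z) (row k Z).
Hypothesis sB : forall a b, B a b != 0 -> s a = s b.

(** The projection onto the block of [B] labelled [j], seen on the side of [A]. *)
Let q j := Z *m diag_mx (\row_b (s b == j)%:R) *m Y.

Lemma block_idempotents : [/\ forall j, q j *m q j = q j, \sum_j q j = 1%:M
   & forall j, admissible A (q j)].
Proof.
split.
- move=> j; rewrite /q !mulmxA -[_ *m Y *m Z]mulmxA YZ mulmx1.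
  rewrite -[Z *m _ *m diag_mx _]mulmxA mulmx_diag; congr (_ *m diag_mx _ *m _).
  by apply/rowP => b; rewrite !mxE; case: eqP => _; rewrite ?mulr1 ?mulr0.
- rewrite /q -mulmx_suml -mulmx_sumr -[RHS]ZY; congr (_ *m _).
  rewrite -[RHS]mulmx1; congr (_ *m _); apply/matrixP => a b.
  rewrite summxE (eq_bigr (fun j => (s a == j)%:R *+ (a == b))); last by move=> j _; rewrite !mxE.
  by rewrite sumrMnl (bigD1 (s a)) //= eqxx big1 ?addr0 ?mxE // => j; rewrite eq_sym => /negPf ->.
- move=> j; apply: admissible_transport (bott_mxdiag bA) ZY hY hZ _ => a b.
  by move=> /sB ->.
Qed.

(** Each [q j] maps block [i] of [A] to itself, so it induces an admissible idempotent of [A_ i],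
    which is zero or the identity. As the [q j] sum to the identity, some [q j] fixes block [i],
    which therefore lies in the summand [j] of [B]. *)
Lemma block_support i : irreducible (A_ i) -> (1 < n_ i)%N ->
  exists j, forall a b, sig1 a = i -> s b != j -> Z a b = 0.
Proof.
move=> irr n1; have [qq q1 qA] := block_idempotents.
have out j a b : sig1 a = i -> sig1 b != i -> q j a b = 0.
  move=> ai bi; rewrite -(sig2K a); move: (sig2 a); rewrite ai => a'.
  have [qA1 _] := qA j.
  (* This column is the functional sending v in block [i] to the coordinate [b] of v q_j. It kills
     each x_c with nonzero character, and that character, since [q j] only scales them and [b] lies
     outside the block. *)
  suff /colP/(_ a') : \col_c q j (Rank i c) b = 0 by rewrite !mxE.
  apply: irreducible_span irr _ _; first by case: (n_ i) n1 => [|[]].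
  move=> c Ac; have [|e [e1 e2]] := qA1 (Rank i c); first by rewrite chr_mxdiag_eq0.
  split.
    rewrite mxE; have /rowP/(_ b) := e1; rewrite mxE => ->; rewrite !mxE.
    by case: eqP => [E|_]; rewrite ?mulr0 //; rewrite -E Rank1K eqxx in bi.
  apply/matrixP => x y; rewrite !ord1 [RHS]mxE.
  have /rowP/(_ b) := e2; rewrite [RHS]mxE [X in _ * X]mxE.
  have -> : A b (Rank i c) = 0.
    by apply/eqP; apply: contraNT bi => /mxdiag_neq0; rewrite Rank1K => ->.
  rewrite mulr0 => <-.
  have -> : (chr A (Rank i c) *m q j) 0 b = (chr A (Rank i c) *m col b (q j)) 0 0.
    by rewrite colE mulmxA -colE [RHS]mxE.
  rewrite mulmx_submx [X in _ = fun_of_matrix X _ _](bigD1 i) //= [X in _ + X]big1 => [|i' ii']; last first.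
    by rewrite chr_mxdiag_submx (negPf ii') mul0mx.
  rewrite addr0 chr_mxdiag_submx eqxx conform_mx_id.
  by congr ((_ *m _) _ _); apply/colP => x'; rewrite !mxE.
have pp j : submxblock (q j) i i *m submxblock (q j) i i = submxblock (q j) i i.
  rewrite -{3}qq submxblock_mul [RHS](bigD1 i) //= [X in _ + X]big1 ?addr0 // => i' ii'.
  suff -> : submxblock (q j) i i' = 0 by rewrite mul0mx.
  by apply/matrixP => a b; rewrite mxE [RHS]mxE out // Rank1K.
have pA j : admissible (A_ i) (submxblock (q j) i i).
  have [qA1 qA2] := qA j; split=> [a Aa|a b Aa Ab]; last first.
    rewrite mxE; apply: qA2; last by rewrite chr_mxdiag_eq0.
    by apply/eqP; rewrite chr_mxdiag_eq0 Aa.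
  have [|c [c1 c2]] := qA1 (Rank i a); first by rewrite chr_mxdiag_eq0.
  exists c; split.
    apply/rowP => b; rewrite [LHS]mxE [LHS]mxE; have /rowP/(_ (Rank i b)) := c1.
    by rewrite [LHS]mxE => ->; rewrite !mxE -(inj_eq val_inj) eq_Rank eqxx.
  have := congr1 (fun v => submxrow v i) c2.
  rewrite submxrow_mul [LHS](bigD1 i) //= [X in _ + X]big1 => [|i' ii']; last first.
    by rewrite chr_mxdiag_submx (negPf ii') mul0mx.
  rewrite addr0 chr_mxdiag_submx eqxx conform_mx_id => ->.
  have := chr_mxdiag_submx A_ a i; rewrite eqxx conform_mx_id => <-.
  by apply/rowP => b; rewrite !mxE.
have /existsP[j /eqP pj] : [exists j, submxblock (q j) i i == 1%:M].
  rewrite -[X in is_true X]negbK negb_exists; apply/negP => /forallP H.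
  have H0 j : submxblock (q j) i i = 0.
    by have [//|E] := irr _ (pp j) (pA j); have := H j; rewrite E eqxx.
  have n0 := ltnW n1; pose a := Ordinal n0.
  have : (\sum_j q j) (Rank i a) (Rank i a) = 0.
    rewrite summxE big1 // => j _.
    by have := congr1 (fun N : 'M['F_2]_(n_ i) => N a a) (H0 j); rewrite mxE [RHS]mxE.
  by rewrite q1 mxE eqxx => /eqP; rewrite oner_eq0.
exists j => a b ai bj.
have : row a (q j) = row a 1%:M.
  apply/rowP => c; rewrite [LHS]mxE [RHS]mxE [RHS]mxE.
  have [ci|ci] := eqVneq (sig1 c) i; last first.
    rewrite out //; case: eqP => // E; by rewrite -E ai eqxx in ci.
  rewrite -(sig2K a) -(sig2K c); move: (sig2 a) (sig2 c); rewrite ai ci => a' c'.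
  have := congr1 (fun N : 'M['F_2]_(n_ i) => N a' c') pj; rewrite mxE => ->.
  by rewrite mxE -(inj_eq val_inj) -[in RHS](inj_eq val_inj) eq_Rank eqxx.
(* Multiplying x_a q_j = x_a by [Z] shows that row [a] of [Z] is fixed by the projection onto block
   [j], so its other entries vanish. *)
move/(congr1 (mulmx^~ Z)); rewrite /q -!row_mul -!mulmxA YZ mul1mx mulmx1.
by move/rowP/(_ b); rewrite [LHS]mxE mul_mx_diag !mxE (negPf bj) mulr0 => <-.
Qed.

End Support.

(* The blocks of size one, whose number is determined by the total size, are
   matched arbitrarily. *)
Lemma extend_matching (k l : nat) (n_ : 'I_k -> nat) (m_ : 'I_l -> nat)
    (R : 'I_k -> 'I_l -> Prop) :
  (forall i, 0 < n_ i)%N -> (forall j, 0 < m_ j)%N ->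
  (\sum_i n_ i = \sum_j m_ j)%N ->
  (forall i, 1 < n_ i -> exists j, R i j)%N ->
  (forall j, 1 < m_ j -> exists i, R i j)%N ->
  (forall i j, R i j -> n_ i = m_ j /\ 1 < n_ i)%N ->
  (forall i j j', R i j -> R i j' -> j = j') ->
  (forall i i' j, R i j -> R i' j -> i = i') ->
  exists2 t : 'I_k -> 'I_l, bijective t &
    forall i, R i (t i) \/ (n_ i = 1 /\ m_ (t i) = 1)%N.
Proof.
move=> n0 m0 nm hR1 hR2 hRn Rf Ri.
case: l => [|l] in m_ R m0 nm hR1 hR2 hRn Rf Ri *.
  have k0 (i : 'I_k) : False.
    move: nm (n0 i); rewrite big_ord0 (bigD1 i) //= => /eqP.
    by rewrite addn_eq0 => /andP[/eqP -> _].
  have kE : k = 0%N by case: k k0 {n_ R n0 nm hR1 hR2 hRn Rf Ri} => // k' /(_ ord0).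
  exists (cast_ord kE) => [|i]; last by case: (k0 i).
  by exists (cast_ord (esym kE)) => i; apply: val_inj.
case: k => [|k] in n_ R n0 nm hR1 hR2 hRn Rf Ri *.
  by move: nm (m0 ord0); rewrite big_ord0 (bigD1 ord0) //= => /esym/eqP; rewrite addn_eq0 => /andP[/eqP -> _].
(* [f] and [g] are meaningful only at sizes above one, where they are mutually inverse. The value
   [ord0] elsewhere is a dummy, which is why the empty cases were treated first. *)
have [f fP] : exists f : 'I_k.+1 -> 'I_l.+1, forall i, (1 < n_ i)%N -> R i (f i).
  apply: fin_all_exists (fun i j => (1 < n_ i)%N -> R i j) _ => i.
  by have [ni|_] := ltnP 1 (n_ i); [have [j Rij] := hR1 i ni; exists j|exists ord0].
have [g gP] : exists g : 'I_l.+1 -> 'I_k.+1, forall j, (1 < m_ j)%N -> R (g j) j.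
  apply: fin_all_exists (fun j i => (1 < m_ j)%N -> R i j) _ => j.
  by have [mj|_] := ltnP 1 (m_ j); [have [i Rij] := hR2 j mj; exists i|exists ord0].
have f1 i : (1 < n_ i)%N -> (1 < m_ (f i))%N by move=> /fP/hRn[->].
have g1 j : (1 < m_ j)%N -> (1 < n_ (g j))%N by move=> /gP/hRn[].
have fK i : (1 < n_ i)%N -> g (f i) = i by move=> ni; apply: Ri (fP _ ni); exact/gP/f1.
have gK j : (1 < m_ j)%N -> f (g j) = j by move=> mj; apply: Rf (gP _ mj); exact/fP/g1.
have reidx (F : 'I_k.+1 -> nat) (G : 'I_l.+1 -> nat) :
    (forall i, (1 < n_ i)%N -> F i = G (f i)) ->
    (\sum_(i | 1 < n_ i) F i = \sum_(j | 1 < m_ j) G j)%N.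
  move=> FG; rewrite (reindex_onto g f) //=; apply: eq_big => [j|j /andP[gj /eqP E]].
    apply/andP/idP => [[gj /eqP E]|mj]; last by rewrite g1 // gK.
    by rewrite -E f1.
  by rewrite FG // E.
pose SA := [set i | n_ i == 1%N]%SET; pose SB := [set j | m_ j == 1%N]%SET.
have nSA i : (i \notin SA) = (1 < n_ i)%N by rewrite inE; have := n0 i; lia.
have mSB j : (j \notin SB) = (1 < m_ j)%N by rewrite inE; have := m0 j; lia.
have cSA : (\sum_i n_ i = #|SA| + \sum_(i | 1 < n_ i) n_ i)%N.
  rewrite (bigID (mem SA)) /= -sum1_card; congr (_ + _)%N; last exact: eq_bigl.
  by apply: eq_bigr => i; rewrite inE => /eqP.
have cSB : (\sum_i m_ i = #|SB| + \sum_(i | 1 < m_ i) m_ i)%N.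
  rewrite (bigID (mem SB)) /= -sum1_card; congr (_ + _)%N; last exact: eq_bigl.
  by apply: eq_bigr => i; rewrite inE => /eqP.
(* [R] preserves sizes, so the sizes above one have equal sums; what remains of the two totals
   counts the ones. *)
have SAB : #|SA| = #|SB|.
  have := reidx n_ m_ (fun i ni => (hRn _ _ (fP _ ni)).1); lia.
have kl : k.+1 = l.+1.
  rewrite -[k.+1]card_ord -[l.+1]card_ord -(cardC SA) -(cardC SB) SAB; congr (_ + _)%N.
  rewrite -!sum1_card (eq_bigl (fun i => 1 < n_ i)%N) // [RHS](eq_bigl (fun i => 1 < m_ i)%N) //.
  exact: reidx.
pose t i := if (1 < n_ i)%N then f i else nth ord0 (enum SB) (index i (enum SA)).
have iSA i : i \in SA -> (index i (enum SA) < size (enum SB))%N.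
  by move=> iA; rewrite -cardE -SAB cardE index_mem mem_enum.
have tSB i : i \in SA -> nth ord0 (enum SB) (index i (enum SA)) \in SB.
  by move=> /iSA iA; rewrite -mem_enum mem_nth.
have ti : injective t.
  move=> i i'; rewrite /t -!nSA; case: ifPn => iA; case: ifPn => iA'.
  - by move/(congr1 g); rewrite !fK // -nSA.
  - by move=> E; move: (tSB i'); rewrite -E -[_ \in SB]negbK mSB f1 -?nSA //; rewrite negbK in iA' => /(_ iA').
  - by move=> E; move: (tSB i); rewrite E -[_ \in SB]negbK mSB f1 -?nSA //; rewrite negbK in iA => /(_ iA).
  - rewrite !negbK in iA iA' *; move/eqP; rewrite nth_uniq ?enum_uniq ?iSA // => /eqP E.
    by rewrite -(@nth_index _ ord0 i (enum SA)) ?mem_enum // E nth_index ?mem_enum.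
exists t; first by apply: inj_card_bij => //; rewrite !card_ord kl.
move=> i; rewrite /t; case: ifPn => [ni|]; first by left; exact: fP.
by rewrite -nSA negbK => iA; right; have := tSB _ iA; move: iA; rewrite !inE => /eqP -> /eqP ->.
Qed.

Lemma eigen_iso1_dim1 n m (A : 'M['F_2]_n) (B : 'M['F_2]_m) :
  bott_matrix A -> bott_matrix B -> n = 1%N -> m = 1%N -> eigen_iso1 A B.
Proof.
move=> bA bB n1 m1; subst n m; exists 1%:M, 1%:M; rewrite !mulmx1; split=> // j.
exists 0 => k; have c0 (C : 'M['F_2]_1) i : bott_matrix C -> chr C i = 0.
  by move=> bC; apply/rowP => x; rewrite !mxE bC // !ord1.
by rewrite !c0 // mul0mx eqxx.
Qed.

Section KRS.
Import tagnat.
Context {k l : nat} {n_ : 'I_k -> nat} {m_ : 'I_l -> nat}.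
Variables (A_ : forall i, 'M['F_2]_(n_ i)) (B_ : forall j, 'M['F_2]_(m_ j)).
Let A := \mxdiag_i A_ i.
Let B := \mxdiag_j B_ j.
Variables (Y : 'M['F_2]_(\sum_j m_ j, \sum_i n_ i)) (Z : 'M['F_2]_(\sum_i n_ i, \sum_j m_ j)).
Hypotheses (ZY : Z *m Y = 1%:M) (YZ : Y *m Z = 1%:M).

Let suppZ i j := forall a b, sig1 a = i -> sig1 b != j -> Z a b = 0.
Let suppY j i := forall b a, sig1 b = j -> sig1 a != i -> Y b a = 0.

(** In the block [(i, i)] of [Z *m Y] only the term through [j] survives. The one-sided inverse also
    gives [n_ i <= m_ j], and the opposite inequality comes from [suppY_inv]. *)
Lemma suppZ_inv i j : suppZ i j -> submxblock Z i j *m submxblock Y j i = 1%:M.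
Proof.
move=> sZ; rewrite -submxblock1 -ZY submxblock_mul [RHS](bigD1 j) //=.
rewrite [X in _ + X]big1 ?addr0 // => j' jj'.
suff -> : submxblock Z i j' = 0 by rewrite mul0mx.
by apply/matrixP => a b; rewrite mxE [RHS]mxE sZ ?Rank1K.
Qed.

Lemma suppY_inv j i : suppY j i -> submxblock Y j i *m submxblock Z i j = 1%:M.
Proof.
move=> sY; rewrite -submxblock1 -YZ submxblock_mul [RHS](bigD1 i) //=.
rewrite [X in _ + X]big1 ?addr0 // => i' ii'.
suff -> : submxblock Y j i' = 0 by rewrite mul0mx.
by apply/matrixP => a b; rewrite mxE [RHS]mxE sY ?Rank1K.
Qed.

(** Characters that differ on block [i] differ in the whole matrix, so the scalar that works for a
    row of [Y] also works for its block. *)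
Lemma block_eigen_iso1 i j :
  (forall j, eigen A (chr B j *m Y) (row j Y)) ->
  suppZ i j -> suppY j i -> eigen_iso1 (A_ i) (B_ j).
Proof.
move=> hY sZ sY; exists (submxblock Y j i), (submxblock Z i j).
split; [exact: suppY_inv|exact: suppZ_inv|move=> b].
have [e he] := hY (Rank j b); exists e => a Aa.
have E : submxrow (chr B (Rank j b) *m Y) i = chr (B_ j) b *m submxblock Y j i.
  rewrite submxrow_mul [LHS](bigD1 j) //= [X in _ + X]big1 => [|j' jj']; last first.
    by rewrite chr_mxdiag_submx (negPf jj') mul0mx.
  by rewrite addr0 chr_mxdiag_submx eqxx conform_mx_id.
have := he (Rank i a); rewrite -E !mxE; apply.
apply: contra Aa => /eqP/(congr1 (fun v => submxrow v i)).
by rewrite E chr_mxdiag_submx eqxx conform_mx_id => ->.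
Qed.

End KRS.

Theorem krull_schmidt k l (n_ : 'I_k -> nat) (m_ : 'I_l -> nat)
    (A_ : forall i, 'M['F_2]_(n_ i)) (B_ : forall j, 'M['F_2]_(m_ j)) :
  (forall i, (0 < n_ i)%N) -> (forall j, (0 < m_ j)%N) ->
  (forall i, bott_matrix (A_ i)) -> (forall j, bott_matrix (B_ j)) ->
  (forall i, irreducible (A_ i)) -> (forall j, irreducible (B_ j)) ->
  eigen_iso (\mxdiag_i A_ i) (\mxdiag_j B_ j) ->
  exists2 t : 'I_k -> 'I_l, bijective t & forall i, eigen_iso1 (A_ i) (B_ (t i)).
Proof.
move=> n0 m0 bA bB irA irB [Y [Z [YZ ZY hY hZ]]].
pose sZ i j := forall a b, tagnat.sig1 a = i -> tagnat.sig1 b != j -> Z a b = 0.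
pose sY j i := forall b a, tagnat.sig1 b = j -> tagnat.sig1 a != i -> Y b a = 0.
have hZ1 i : (1 < n_ i)%N -> exists j, sZ i j.
  move=> ni; apply: (block_support bA ZY YZ hY hZ _ (irA i) ni).
  by move=> a b; exact: mxdiag_neq0.
have hY1 j : (1 < m_ j)%N -> exists i, sY j i.
  move=> mj; apply: (block_support bB YZ ZY hZ hY _ (irB j) mj).
  by move=> a b; exact: mxdiag_neq0.
have one_neq0 d : (0 < d)%N -> (1%:M : 'M['F_2]_d) <> 0.
  by case: d => // d _ /matrixP/(_ 0 0); rewrite !mxE => /eqP; rewrite oner_eq0.
have sZY i j j' : (0 < n_ i)%N -> sZ i j -> sZ i j' -> j = j'.
  move=> ni s s'; apply/eqP; apply: contraT => jj'; case: (one_neq0 _ ni).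
  rewrite -(suppZ_inv ZY s'); suff -> : submxblock Z i j' = 0 by rewrite mul0mx.
  by apply/matrixP => a b; rewrite mxE [RHS]mxE s ?tagnat.Rank1K // eq_sym.
have sYZ j i i' : (0 < m_ j)%N -> sY j i -> sY j i' -> i = i'.
  move=> mj s s'; apply/eqP; apply: contraT => ii'; case: (one_neq0 _ mj).
  rewrite -(suppY_inv YZ s'); suff -> : submxblock Y j i' = 0 by rewrite mul0mx.
  by apply/matrixP => a b; rewrite mxE [RHS]mxE s ?tagnat.Rank1K // eq_sym.
pose R i j := [/\ sZ i j, sY j i & (1 < n_ i)%N].
have RZ i j : sZ i j -> (1 < n_ i)%N -> R i j.
  (* Block [j] is at least as large as block [i], so it is in turn supported on one block [i']. Were
     [i'] not [i], the block of [Y] inverting that of [Z] would be zero. *)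
  move=> s ni; have := mulmx1_min (suppZ_inv ZY s) => /(leq_trans ni) mj.
  have [i' s'] := hY1 _ mj; suff E : i = i' by split=> //; rewrite E.
  apply/eqP; apply: contraT => ii'; case: (one_neq0 _ (n0 i)).
  rewrite -(suppZ_inv ZY s); suff -> : submxblock Y j i = 0 by rewrite mulmx0.
  by apply/matrixP => a b; rewrite mxE [RHS]mxE s' ?tagnat.Rank1K.
have [||||||t tb tP] := @extend_matching k l n_ m_ R n0 m0.
- apply/eqP; rewrite eqn_leq; apply/andP; split; [exact: mulmx1_min ZY|exact: mulmx1_min YZ].
- by move=> i ni; have [j /RZ] := hZ1 _ ni; exists j; auto.
- move=> j mj; have [i s] := hY1 _ mj; exists i.
  have := mulmx1_min (suppY_inv YZ s) => /(leq_trans mj) ni.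
  have [j' s'] := hZ1 _ ni; suff E : j = j' by split=> //; rewrite E.
  apply/eqP; apply: contraT => jj'; case: (one_neq0 _ (m0 j)).
  rewrite -(suppY_inv YZ s); suff -> : submxblock Z i j = 0 by rewrite mulmx0.
  by apply/matrixP => a b; rewrite mxE [RHS]mxE s' ?tagnat.Rank1K.
- move=> i j [s s' ni]; split=> //; apply/eqP; rewrite eqn_leq; apply/andP.
  by split; [exact: mulmx1_min (suppZ_inv ZY s)|exact: mulmx1_min (suppY_inv YZ s')].
- by move=> i j j' [s _ _] [s' _ _]; exact: sZY s s'.
- by move=> i i' j [_ s _] [_ s' _]; exact: sYZ s s'.
exists t => // i; have [[s s' _]|[ni mi]] := tP i.
  exact: block_eigen_iso1 ZY YZ _ _ hY s s'.
exact: eigen_iso1_dim1.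
Qed.

(* By multilinearity of the determinant in the rows. *)
Lemma unitmx_row_choice (F : fieldType) n (P Q : 'M[F]_n) :
  P + Q \in unitmx ->
  exists c : pred 'I_n, (\matrix_i if c i then row i P else row i Q) \in unitmx.
Proof.
move=> PQ.
(* Rows before [t] have been chosen and the others are still those of [P + Q]; passing from [t] to
   [t.+1] splits one determinant into two, not both zero. *)
pose M (c : pred 'I_n) t := \matrix_i
  (if (i < t)%N then if c i then row i P else row i Q else row i (P + Q)).
suff H t : exists c, M c t \in unitmx.
  have [c cu] := H n; exists c; suff <- : M c n = \matrix_i (if c i then row i P else row i Q) by [].
  by apply/row_matrixP => i; rewrite !rowK ltn_ord.
elim: t => [|t [c cu]].
  exists xpred0; suff -> : M xpred0 0%N = P + Q by [].
  by apply/row_matrixP => i; rewrite !rowK.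
have [tn|nt] := ltnP t n; last first.
  exists c; suff -> : M c t.+1 = M c t by [].
  apply/row_matrixP => i; rewrite !rowK.
  have it : (i < t)%N by exact: leq_trans (ltn_ord i) nt.
  by rewrite it ltnS ltnW.
pose k := Ordinal tn.
pose c1 b := fun i => if i == k then b else c i.
have r' b : row' k (M (c1 b) t.+1) = row' k (M c t).
  apply/matrixP => i j; rewrite mxE [LHS]mxE [RHS]mxE [RHS]mxE /c1.
  rewrite eq_sym (negPf (neq_lift k i)) ltnS leq_eqVlt.
  suff -> : (lift k i == t :> nat) = false by [].
  by apply/negbTE; rewrite eq_sym; exact: (neq_lift k i).
have := @determinant_multilinear F n (M c t) (M (c1 true) t.+1) (M (c1 false) t.+1) k 1 1.
rewrite !rowK /c1 ltnn leqnn eqxx !scale1r !mul1r linearD => /(_ erefl (r' _) (r' _)) E.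
have : \det (M (c1 true) t.+1) != 0 \/ \det (M (c1 false) t.+1) != 0.
  apply/orP; rewrite -negb_and; apply: contraTN cu => /andP[/eqP e1 /eqP e2].
  by rewrite unitmxE E e1 e2 addr0 unitr0.
by case=> H; [exists (c1 true)|exists (c1 false)]; rewrite unitmxE unitfE.
Qed.

Lemma idempotent_unit (F : fieldType) n (p : 'M[F]_n) :
  p *m p = p -> p \in unitmx -> p = 1%:M.
Proof. by move=> pp pu; rewrite -[LHS](mulKmx pu) pp mulVmx. Qed.

Section Sort.
Context (n : nat) (A : 'M['F_2]_n) (c : pred 'I_n) (r : 'I_n -> nat).
Hypotheses (Ac : forall i k, A i k != 0 -> c i = c k)
  (Ar : forall i k, A i k != 0 -> (r i < r k)%N).
Import tagnat.

Let L (i : 'I_2) := sort (fun a b => (r a <= r b)%N) (enum [pred k | c k == (i == 0)]).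
Let d i := size (L i).
Let s i (x : 'I_(d i)) := tnth (in_tuple (L i)) x.
Let C i : 'M['F_2]_(d i) := \matrix_(x, y) A (s x) (s y).
Let g (a : 'I_(\sum_i d i)) := s (sig2 a).

(** Block 0 lists the indices where [c] holds and block 1 the others, each by increasing [r]. [Ac]
    kills the entries between the blocks, and [Ar] makes each sorted block strictly upper
    triangular. *)
Lemma sort_block : exists (d : 'I_2 -> nat) (C : forall i, 'M['F_2]_(d i))
    (g : 'I_(\sum_i d i) -> 'I_n),
  [/\ bijective g, forall i, bott_matrix (C i),
      \mxdiag_i C i = mxsub g g A &
      forall i, d i = #|[pred k | c k == (i == 0)]|].
Proof.
have cs i x : c (@s i x) = (i == 0).
  by have := mem_tnth x (in_tuple (L i)); rewrite mem_sort mem_enum inE => /eqP.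
have dE i : d i = #|[pred k | c k == (i == 0)]| by rewrite /d size_sort -cardE.
have sI i : injective (@s i).
  by move=> x y; apply: (tuple_uniqP (in_tuple (L i)) _); rewrite sort_uniq enum_uniq.
have gI : injective g.
  move=> a b; rewrite /g => E; have E1 : sig1 a = sig1 b.
    have := cs _ (sig2 a); rewrite E cs.
    by case: (sig1 a) (sig1 b) => [[|[|]]] // ? [[|[|]]] // ? _; apply: val_inj.
  rewrite -(sig2K a) -(sig2K b); move: (sig2 a) (sig2 b) E; rewrite E1.
  by move=> x y /sI ->.
exists d, C, g; split=> //.
- apply: inj_card_bij => //; rewrite !card_ord big_ord_recl big_ord1 !dE.
  rewrite -[leqLHS]card_ord -(cardC [pred k | c k == true]); apply: eq_leq; congr (_ + _)%N.
  by apply: eq_card => k; rewrite !inE; case: (c k).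
- move=> i x y yx; rewrite mxE; apply/eqP; apply: contraTT isT => /Ar.
  suff : (r (s y) <= r (s x))%N by lia.
  have x0 : 'I_n := s x; rewrite /s !(tnth_nth (s x)) /=.
  apply: (@sorted_leq_nth _ (fun a b => (r a <= r b)%N)) => //.
  + by move=> a b e; exact: leq_trans.
  + by apply: sort_sorted => a b; exact: leq_total.
  + by rewrite inE; exact: ltn_ord.
  + by rewrite inE; exact: ltn_ord.
- apply/matrixP => a b; rewrite [RHS]mxE /g; have [E|ab] := eqVneq (sig1 a) (sig1 b); last first.
    have -> : A (s (sig2 a)) (s (sig2 b)) = 0.
      apply/eqP; apply: contraNT ab => /Ac; rewrite !cs.
      by case: (sig1 a) (sig1 b) => [[|[|]]] // ? [[|[|]]] // ? _.
    by apply/eqP; apply: contraNT ab => /mxdiag_neq0 ->.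
  rewrite -[in LHS](sig2K a) -[in LHS](sig2K b); move: (sig2 a) (sig2 b); rewrite E => x y.
  by rewrite mxdiag_Rank mxE.
Qed.

End Sort.

(* The rows of [Y], each a row of [p] or of [1 - p], form a basis in which [p] is
   diagonal; listing the coordinates with zero character first, and the others
   in their original order, keeps the matrix triangular. *)
Lemma reducible_split n (A p : 'M['F_2]_n) :
  bott_matrix A -> p *m p = p -> admissible A p -> p <> 0 -> p <> 1%:M ->
  exists (d : 'I_2 -> nat) (C : forall i, 'M['F_2]_(d i)),
    [/\ forall i, (0 < d i)%N, forall i, bott_matrix (C i)
      & eigen_iso1 A (\mxdiag_i C i)].
Proof.
move=> bA pp [pA1 pA2] p0 p1.
have [|c] := @unitmx_row_choice _ n p (1%:M - p); first by rewrite addrC subrK unitmx1.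
set Y := \matrix_i _ => Yu; pose Z := invmx Y.
have ZY : Z *m Y = 1%:M by exact: mulVmx.
have YZ : Y *m Z = 1%:M by exact: mulmxV.
have rY k : row k Y = if c k then row k p else row k (1%:M - p) by rewrite rowK.
have rY0 k : row k Y <> 0.
  move=> E; have : row k (Y *m Z) = 0 by rewrite row_mul E mul0mx.
  by rewrite YZ => /rowP/(_ k); rewrite !mxE eqxx => /eqP; rewrite oner_eq0.
(* Here [p] scales x_k by some e, so [p] and [1 - p] have rows e x_k and (1 - e) x_k. The one chosen
   is nonzero, hence it is x_k and [c k] records e. *)
have cA k : chr A k != 0 -> [/\ row k Y = row k 1%:M & chr A k *m p = (c k)%:R *: chr A k].
  move=> /pA1[e [e1 e2]]; have := rY0 k; rewrite rY linearB /= e1.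
  case: (F2_cases e) e1 e2 => -> e1 e2; rewrite ?scale0r ?scale1r ?subrr ?subr0;
    case: (c k) => //; by rewrite e2 ?scale0r ?scale1r.
have Yk j k : chr A k != 0 -> Y j k = (j == k)%:R.
  move=> Ak; have [Aj|/cA[/rowP/(_ k)]] := eqVneq (chr A j) 0; last by rewrite mxE [RHS]mxE [RHS]mxE.
  have jk : j != k by apply: contraNneq Ak => <-; rewrite Aj.
  have /rowP/(_ k) := rY j; rewrite mxE => ->; case: (c j).
    by rewrite mxE pA2 // (negPf jk).
  by rewrite !mxE pA2 // (negPf jk) subr0.
(* The matrix in the new basis: column [k] holds the coordinates of alpha_k with respect to the rows
   of [Y]. *)
pose A' := \matrix_(i, k) (chr A k *m Z) 0 i.
have chrA' k : chr A' k = chr A k *m Z by apply/rowP => i; rewrite mxE [LHS]mxE.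
pose D := diag_mx (\row_i (c i)%:R : 'rV['F_2]_n).
have YpD : Y *m p = D *m Y.
  apply/row_matrixP => i; rewrite row_mul rY mul_diag_mx.
  transitivity ((c i)%:R *: row i Y); last by apply/rowP => j; rewrite !mxE.
  rewrite rY; case: (c i); rewrite ?scale1r ?scale0r -row_mul ?pp //.
  by rewrite mulmxBl mul1mx pp subrr linear0.
have A'0 i k : A' i k != 0 -> chr A k != 0.
  by rewrite mxE; apply: contraNneq => ->; rewrite mul0mx mxE.
have A'c i k : A' i k != 0 -> c i = c k.
  move=> Aik; have [_ /(congr1 (mulmx^~ Z))] := cA k (A'0 _ _ Aik).
  rewrite -mulmxA (_ : p *m Z = Z *m D); last first.
    by rewrite -[LHS]mul1mx -ZY -[Z *m Y *m _]mulmxA [Y *m _]mulmxA YpD -[D *m Y *m Z]mulmxA YZ mulmx1.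
  rewrite mulmxA -scalemxAl => /rowP/(_ i); rewrite mul_mx_diag [LHS]mxE [RHS]mxE [(\row__ _) _ _]mxE.
  move: Aik; rewrite [A' i k]mxE => /F2_neq0 ->; rewrite mul1r mulr1.
  by case: (c i); case: (c k) => // /eqP; rewrite ?oner_eq0 // eq_sym oner_eq0.
pose r i := ((chr A i != 0%R) * n + i)%N.
have A'r i k : A' i k != 0 -> (r i < r k)%N.
  move=> Aik; rewrite /r (A'0 _ _ Aik) mul1n.
  have [Ai|Ai] := eqVneq (chr A i) 0; first by have := ltn_ord i; lia.
  rewrite mul1n ltn_add2l ltnNge; apply: contra Aik => ki; apply/eqP.
  rewrite mxE -[RHS](bA _ _ ki); have -> : A i k = chr A k 0 i by rewrite mxE.
  rewrite -[chr A k in RHS]mulmx1 -ZY mulmxA [RHS]mxE (bigD1 i) //= Yk // eqxx mulr1.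
  by rewrite big1 ?addr0 // => j ji; rewrite Yk // (negPf ji) mulr0.
have [d [C [g [gb bC CE dE]]]] := sort_block A'c A'r.
exists d, C; split=> // [i|].
  rewrite dE lt0n; apply/negP => /eqP/card0_eq H.
  have {}H k : c k = (i != 0) by have := H k; rewrite inE; case: (c k) (i == 0) => -[].
  (* If a block were empty, [Y] would be [p] or [1 - p], and an invertible idempotent is the
     identity. *)
  have YE : Y = if i != 0 then p else 1%:M - p.
    by apply/row_matrixP => k; rewrite rY H; case: ifP.
  move: YE Yu; case: ifP => _ ->.
    by move/(idempotent_unit pp).
  move/idempotent_unit; rewrite mulmxBl mul1mx mulmxBr mulmx1 pp subrr subr0 => /(_ erefl).
  by move/eqP; rewrite subr_eq -[X in X == _]addr0 (inj_eq (addrI _)) => /eqP/esym.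
exists (rowsub g Y), (colsub g Z); split.
- apply/matrixP => a b; rewrite !mxE -(bij_eq gb) -[LHS](_ : (Y *m Z) (g a) (g b) = _).
    by rewrite YZ mxE.
  by rewrite mxE; apply: eq_bigr => i _; rewrite [X in _ = X * _]mxE [X in _ = _ * X]mxE.
- apply/matrixP => i j; rewrite -ZY [RHS]mxE [RHS](reindex g) /=; last exact: onW_bij.
  by rewrite mxE; apply: eq_bigr => a _; rewrite [X in X * _ = _]mxE [X in _ * X = _]mxE.
- move=> a; have -> : chr (\mxdiag_i C i) a *m rowsub g Y = chr A (g a).
    rewrite CE -[RHS]mulmx1 -ZY mulmxA -chrA'; apply/rowP => j.
    rewrite [RHS]mxE [RHS](reindex g) /=; last exact: onW_bij.
    rewrite mxE; apply: eq_bigr => b _.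
    by rewrite [X in X * _ = _]mxE [X in X * _ = _]mxE [X in _ * X = _]mxE [X in _ = X * _]mxE.
  (* The new basis vectors lie in E(a) itself, so the multiple of a is zero. *)
  exists 0 => j Aj; rewrite mul0r mxE mxE.
  have [E|Aj0] := eqVneq (chr A j) 0.
    move: Aj; rewrite E eq_sym => Aga.
    have [/rowP/(_ j)] := cA _ Aga; rewrite [LHS]mxE [RHS]mxE => -> _; rewrite mxE.
    by case: (g a =P j) Aga => // ->; rewrite E eqxx.
  by rewrite Yk //; case: (g a =P j) Aj => // <-; rewrite eqxx.
Qed.

(** * The deck group *)

Definition sgF (R : pzRingType) (x : 'F_2) : R := (-1) ^+ (x : nat).

Lemma sgF0 (R : pzRingType) : sgF R 0 = 1. Proof. by []. Qed.
Lemma sgF1 (R : pzRingType) : sgF R 1 = -1. Proof. by rewrite /sgF expr1. Qed.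

Lemma sgFD (R : pzRingType) x y : sgF R (x + y) = sgF R x * sgF R y.
Proof.
case: (F2_cases x) => ->; case: (F2_cases y) => ->; rewrite ?add0r ?addr0 ?sgF0 ?mulr1 ?mul1r //.
by rewrite sgF1 mulrNN mulr1.
Qed.

Lemma sgF_sqr (R : pzRingType) x : sgF R x * sgF R x = 1.
Proof. by rewrite /sgF -expr2 sqrr_sign. Qed.

Lemma sgF_intr (R : pzRingType) x : (sgF int x)%:~R = sgF R x.
Proof. by case: (F2_cases x) => ->; rewrite ?sgF0 ?sgF1 ?rmorphN rmorph1. Qed.

Lemma sgF_F2 x : sgF 'F_2 x = 1.
Proof. by case: (F2_cases x) => ->; rewrite ?sgF1 //; apply: val_inj. Qed.

Lemma F2_opp (x : 'F_2) : - x = x.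
Proof. by case: (F2_cases x) => ->; apply: val_inj. Qed.

Lemma F2_addxx (x : 'F_2) : x + x = 0.
Proof. by rewrite -{1}[x]F2_opp addNr. Qed.

Definition mod2 n (v : 'rV[int]_n) : 'rV['F_2]_n := map_mx intr v.

(* The group of lifts of [G(A)] to the universal cover, on the set [Z^n]. *)
Definition gmul n (A : 'M['F_2]_n) (v w : 'rV[int]_n) : 'rV[int]_n :=
  \row_j (v 0 j + sgF int ((mod2 v *m A) 0 j) * w 0 j).

Definition gen n (k : 'I_n) : 'rV[int]_n := row k 1%:M.

Lemma mod2D n (v w : 'rV[int]_n) : mod2 (v + w) = mod2 v + mod2 w.
Proof. by rewrite /mod2 map_mxD. Qed.

Lemma mod2_gen n (k : 'I_n) : mod2 (gen k) = row k 1%:M.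
Proof. by rewrite /mod2 map_row map_mx1. Qed.

Lemma mod2_even n (v : 'rV[int]_n) : mod2 (v *+ 2) = 0.
Proof. by rewrite mulr2n mod2D; apply/rowP => j; rewrite !mxE F2_addxx. Qed.

Lemma mod2_gmul n (A : 'M['F_2]_n) v w : mod2 (gmul A v w) = mod2 v + mod2 w.
Proof. by apply/rowP => j; rewrite !mxE rmorphD rmorphM /= sgF_intr sgF_F2 mul1r. Qed.

Lemma gmul_genE n (A : 'M['F_2]_n) k w j :
  gmul A (gen k) w 0 j = (k == j)%:R + sgF int (A k j) * w 0 j.
Proof. by rewrite mxE mod2_gen -row_mul mul1mx !mxE. Qed.

Lemma gmul_even n (A : 'M['F_2]_n) u w : gmul A (u *+ 2) w = u *+ 2 + w.
Proof. by apply/rowP => j; rewrite mxE mod2_even mul0mx [RHS]mxE [in X in sgF _ X]mxE sgF0 mul1r. Qed.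

Lemma mod2_eq0 n (v : 'rV[int]_n) : mod2 v = 0 -> exists u, v = u *+ 2.
Proof.
move=> v0; exists (\row_j (v ord0 j %/ 2)%Z); apply/rowP => j; rewrite mulmxnE mxE.
have := congr1 (fun x : 'rV__ => x 0 j) v0; rewrite !mxE => /eqP.
have -> : ((v 0 j)%:~R == 0 :> 'F_2) = (2 %| v ord0 j)%Z.
  by rewrite -(dvdz_pcharf (pchar_Fp _)).
by move=> /divzK E; rewrite -[RHS]mulr_natr [RHS]E.
Qed.

(* Peel off one odd coordinate at a time. *)
Lemma gmul_ind n (A : 'M['F_2]_n) (P : 'rV[int]_n -> Prop) :
  bott_matrix A ->
  (forall u, P (u *+ 2)) -> (forall k v, P v -> P (gmul A (gen k) v)) ->
  forall v, P v.
Proof.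
move=> bA P2 Pg v; move: {2}#|_|.+1 (ltnSn #|[pred k | mod2 v 0 k != 0]|) => N.
elim: N v => // N IH v vN.
have [/mod2_eq0[u ->] //|/row_neq0[k vk]] := eqVneq (mod2 v) 0.
(* The inverse of [gen k] times [v]: it has the parities of [v] except at [k], where it is even. *)
pose w := \row_j (sgF int (A k j) * (v 0 j - (k == j)%:R)).
have -> : v = gmul A (gen k) w.
  by apply/rowP => j; rewrite gmul_genE mxE mulrA sgF_sqr mul1r addrC subrK.
apply/Pg/IH; rewrite -ltnS; apply: leq_trans vN; rewrite ltnS.
apply: proper_card; apply/properP; split.
  apply/fintype.subsetP => j; rewrite !inE !mxE rmorphM /= sgF_intr sgF_F2 mul1r rmorphB /=.
  have [<- _|kj] := eqVneq k j; first by move: vk; rewrite mxE.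
  by rewrite subr0.
exists k; rewrite !inE //; rewrite !mxE rmorphM /= sgF_intr sgF_F2 mul1r rmorphB /= eqxx.
by move: vk; rewrite mxE => /F2_neq0 ->; rewrite subrr eqxx.
Qed.

Lemma gmul_gen_gen n (A : 'M['F_2]_n) k : bott_matrix A -> gmul A (gen k) (gen k) = gen k *+ 2.
Proof.
move=> bA; apply/rowP => j; rewrite gmul_genE mulmxnE !mxE.
by case: eqP => [<-|_]; rewrite ?mulr0 // bA // sgF0 mul1r.
Qed.

(** On the even vectors [h] is additive, and it vanishes on 2 e_k, which is the square of e_k
    because the diagonal of [A] is zero. So [h] kills all even vectors, and [gmul_ind] reduces the
    rest to the generators. *)
Lemma hom_F2 n (A : 'M['F_2]_n) (h : 'rV[int]_n -> 'F_2) :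
  bott_matrix A -> (forall v w, h (gmul A v w) = h v + h w) ->
  forall v, h v = \sum_k mod2 v 0 k * h (gen k).
Proof.
move=> bA hM; pose H u := h (u *+ 2).
have HD u w : H (u + w) = H u + H w by rewrite /H mulrnDl -(gmul_even A) hM.
have H0 : H 0 = 0 by apply: (addrI (H 0)); rewrite -HD !addr0.
have HN u : H (- u) = - H u by apply/eqP; rewrite -addr_eq0 -HD addNr H0.
have Hz u : H u = 0.
  have -> : u = \sum_k u 0 k *: gen k.
    apply/rowP => j; rewrite summxE (bigD1 j) //= big1 => [|k kj].
      by rewrite !mxE eqxx mulr1 addr0.
    by rewrite !mxE (negPf kj) mulr0.
  apply: (big_ind (fun x => H x = 0)) => // [x y Hx Hy|k _]; first by rewrite HD Hx Hy addr0.
  have Hk : H (gen k) = 0 by rewrite /H -(gmul_gen_gen k bA) hM; case: (F2_cases (h (gen k))) => ->; apply: val_inj.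
  case: (u 0 k) => m.
    by elim: m => [|m IH]; rewrite ?scale0r // intS scalerDl scale1r HD Hk IH addr0.
  rewrite NegzE scaleNr HN; apply/eqP; rewrite oppr_eq0; apply/eqP.
  by elim: m.+1 => [|m' IH]; rewrite ?scale0r // intS scalerDl scale1r HD Hk IH addr0.
apply: (gmul_ind bA) => [u|k v IH].
  by rewrite [LHS]Hz mod2_even big1 // => k _; rewrite mxE mul0r.
rewrite hM IH mod2_gmul; under [RHS]eq_bigr do rewrite mxE mulrDl.
rewrite big_split /=; congr (_ + _); rewrite mod2_gen (bigD1 k) //= big1 => [|j jk].
  by rewrite !mxE eqxx mul1r addr0.
by rewrite !mxE eq_sym (negPf jk) mul0r.
Qed.

Section Hom.
Context (n m : nat) (A : 'M['F_2]_n) (B : 'M['F_2]_m) (phi : 'rV[int]_n -> 'rV[int]_m).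
Hypotheses (bA : bott_matrix A)
  (phiM : forall v w, phi (gmul A v w) = gmul B (phi v) (phi w)).

Definition hom_mx : 'M['F_2]_(m, n) := \matrix_(j, k) mod2 (phi (gen k)) 0 j.

Lemma mod2_hom v : mod2 (phi v) = mod2 v *m hom_mx^T.
Proof.
apply/rowP => j.
rewrite (hom_F2 (h := fun v => mod2 (phi v) 0 j) bA); last first.
  by move=> u w; rewrite phiM mod2_gmul mxE.
by rewrite [RHS]mxE; apply: eq_bigr => k _; rewrite [X in _ = _ * X]mxE [X in _ = _ * X]mxE.
Qed.

(* A component [f] of [phi] is a cocycle twisted by the character [a].
   Conjugating [2 e_k] gives [f (2 e_k) = 0] unless [alpha_k = a]; commuting
   [e_k] and [e_l] gives [f e_k = f e_l] when [a] is nonzero on both. *)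
Lemma hom_eigen j : eigen A (chr B j *m hom_mx) (row j hom_mx).
Proof.
set a := chr B j *m hom_mx.
have [f fE] : exists f : 'rV[int]_n -> int, forall v, f v = phi v 0 j by exists (fun v => phi v 0 j).
have fM v w : f (gmul A v w) = f v + sgF int ((mod2 v *m a^T) 0 0) * f w.
  rewrite !fE phiM mxE; congr (_ + sgF _ _ * _).
  rewrite mod2_hom /a trmx_mul mulmxA; set x := mod2 v *m _.
  rewrite mxE [RHS]mxE; apply: eq_bigr => i _.
  by rewrite [X in _ = _ * X]mxE [X in _ = _ * X]mxE.
have ag k : (mod2 (gen k) *m a^T) 0 0 = a 0 k by rewrite mod2_gen -row_mul mul1mx !mxE.
have ae u : (mod2 (u *+ 2) *m a^T) 0 0 = 0 by rewrite mod2_even mul0mx mxE.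
have fe u w : f (u *+ 2 + w) = f (u *+ 2) + f w by rewrite -(gmul_even A) fM ae sgF0 mul1r.
have f0 : f 0 = 0 by have := fe 0 0; rewrite mul0rn addr0 => E; apply: (addrI (f 0)); rewrite -E addr0.
have feN u : f (- (u *+ 2)) = - f (u *+ 2).
  have := fe u (- (u *+ 2)); rewrite subrr f0 => /esym/eqP.
  by rewrite addrC addr_eq0 => /eqP.
have fes u x : f ((sgF int x *: u) *+ 2) = sgF int x * f (u *+ 2).
  case: (F2_cases x) => ->; rewrite ?sgF0 ?sgF1 ?scale1r ?mul1r //.
  by rewrite scaleN1r mulN1r mulNrn feN.
have C1 k : chr A k != a -> f (gen k *+ 2) = 0.
  move=> Aka; have [i Ai] : exists i, A i k != a 0 i.
    have [|i] := @row_neq0 _ (chr A k - a); first by rewrite subr_eq0.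
    by rewrite !mxE subr_eq0; exists i; rewrite mxE.
  (* Moving e_i past 2 e_k changes the sign of the latter according to [A i k], while [f] twists it
     according to the entry [i] of [a]. The index [i] was chosen where these signs differ. *)
  have : f (gmul A (gen i) (gen k *+ 2)) = f ((sgF int (A i k) *: gen k) *+ 2 + gen i).
    congr f; apply/rowP => l; rewrite gmul_genE [RHS]mxE !mulmxnE !mxE addrC.
    by case: (k =P l) => [->|_] /=; rewrite ?mul0rn ?mulr0 ?mul0rn // mulr1 mulrnAr mulr1.
  rewrite fM ag fe fes addrC => /addIr.
  case: (F2_cases (A i k)) Ai => ->; case: (F2_cases (a 0 i)) => ->;
    rewrite ?eqxx // ?sgF0 ?sgF1 => _; move: (f _) => z; lia.
(* As 2 e_k is the square of e_k and [a] is trivial on e_k, the vanishing value is twice that of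
   e_k. *)
have C2 k : chr A k != a -> a 0 k = 0 -> f (gen k) = 0.
  by move=> /C1 + ak; rewrite -(gmul_gen_gen k bA) fM ag ak sgF0; lia.
have C3 (k l : 'I_n) : (k < l)%N -> a 0 k = 1 -> a 0 l = 1 -> f (gen k) = f (gen l).
  move=> kl ak al.
  have fN : f (- gen l) = f (gen l).
    have : f (gmul A (gen l) (- gen l)) = 0.
      rewrite -f0; congr f; apply/rowP => i; rewrite gmul_genE !mxE.
      by case: eqP => [<-|_]; rewrite ?oppr0 ?mulr0 ?addr0 // bA // sgF0 mul1r subrr.
    by rewrite fM ag al sgF1; move: (f _) (f _) => x y; lia.
  have fs x : f (sgF int x *: gen l) = f (gen l).
    by case: (F2_cases x) => ->; rewrite ?sgF0 ?sgF1 ?scale1r ?scaleN1r.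
  have ms x : mod2 (sgF int x *: gen l) = mod2 (gen l).
    by apply/rowP => i; rewrite !mxE rmorphM /= sgF_intr sgF_F2 mul1r.
  (* The relation says that e_k e_l is e_l or its inverse, times e_k. Both have the same value under
     [f] since [a] is 1 at [l], and the relation becomes f(e_k) - f(e_l) = f(e_l) - f(e_k). *)
  have : f (gmul A (gen k) (gen l)) = f (gmul A (sgF int (A k l) *: gen l) (gen k)).
    congr f; apply/rowP => i; rewrite gmul_genE [RHS]mxE ms mod2_gen -row_mul mul1mx !mxE.
    case: (k =P i) => [<-|_] /=; case: (l =P _) => [E|_] /=;
      rewrite ?(mulr0, addr0, add0r, mulr1) //.
      by move: kl; rewrite E ltnn.
      by rewrite (bA (ltnW kl)) sgF0.
    by rewrite E.
  by rewrite !fM ms !ag ak al fs sgF1; move: (f _) (f _) => x y; lia.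
have C4 k l : a 0 k = 1 -> a 0 l = 1 -> f (gen k) = f (gen l).
  by move=> ak al; case: (ltngtP k l) => [kl|lk|/val_inj ->] //; [exact: C3|exact/esym/C3].
(* By [C4] the value of [f] is the same at all e_k where [a] is 1; its parity is the required
   scalar. If no such [k] lies outside the class of [a], zero will do. *)
have [/existsP[k0 /andP[Ak0 /eqP ak0]]|] := boolP [exists k, (chr A k != a) && (a 0 k == 1)].
  exists (hom_mx j k0) => k Ak; rewrite mxE mxE mxE -fE [hom_mx _ _]mxE mxE -fE.
  case: (F2_cases (a 0 k)) => ak; rewrite ak ?mulr1 ?mulr0; first by rewrite C2.
  by rewrite (C4 k k0).
rewrite negb_exists => /forallP H; exists 0 => k Ak; rewrite mul0r mxE mxE mxE -fE.
case: (F2_cases (a 0 k)) => ak; first by rewrite C2.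
by have := H k; rewrite Ak ak eqxx.
Qed.

End Hom.

(** The maps are asked to be inverse only mod 2: lifts of a map and of its inverse compose to a deck
    transformation, so they induce inverse homomorphisms only up to conjugation. *)
Lemma eigen_iso_of_hom n m (A : 'M['F_2]_n) (B : 'M['F_2]_m)
    (phi : 'rV[int]_n -> 'rV[int]_m) (psi : 'rV[int]_m -> 'rV[int]_n) :
  bott_matrix A -> bott_matrix B ->
  (forall v w, phi (gmul A v w) = gmul B (phi v) (phi w)) ->
  (forall v w, psi (gmul B v w) = gmul A (psi v) (psi w)) ->
  (forall v, mod2 (psi (phi v)) = mod2 v) -> (forall w, mod2 (phi (psi w)) = mod2 w) ->
  eigen_iso A B.
Proof.
move=> bA bB hphi hpsi pK qK; exists (hom_mx phi), (hom_mx psi).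
have mxid d (M : 'M['F_2]_d) : (forall v, mod2 v *m M^T = mod2 v) -> M = 1%:M.
  move=> H; apply: trmx_inj; rewrite trmx1; apply/row_matrixP => i.
  by rewrite -[M^T]mul1mx row_mul -(mod2_gen i) H.
split; [| |exact: hom_eigen|exact: hom_eigen]; apply: mxid => v; rewrite trmx_mul mulmxA.
  by rewrite -(mod2_hom bB hpsi) -(mod2_hom bA hphi) qK.
by rewrite -(mod2_hom bA hphi) -(mod2_hom bB hpsi) pK.
Qed.

(** * Smooth maps *)

(* The scalar analogue of [Ck_on], to which it reduces by [Ck_onP]. *)
Fixpoint Ck (R : realType) (n k : nat) (U : set 'rV[R]_n) (f : 'rV[R]_n -> R) : Prop :=
  (forall x, U x -> {for x, continuous f}) /\
  if k is k'.+1 then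
    forall i : 'I_n,
      (forall x, U x -> derivable f x (delta_mx 0 i)) /\
      Ck k' U (fun x => 'D_(delta_mx 0 i) f x)
  else True.

Lemma near_continuous (T S : topologicalType) (f g : T -> S) (x : T) :
  (\forall y \near x, f y = g y) -> {for x, continuous f} -> {for x, continuous g}.
Proof.
move=> fg; rewrite /prop_for /continuous_at -(nbhs_singleton fg) => cf.
by apply: cvg_trans cf; exact: near_eq_cvg.
Qed.

Section Ck.
Context {R : realType} {n : nat}.
Implicit Types (U V : set 'rV[R]_n) (f g : 'rV[R]_n -> R).

Lemma Ck_continuous k U f : Ck k U f -> forall x, U x -> {for x, continuous f}.
Proof. by case: k => [|k] []. Qed.

Lemma CkS k U f : Ck k.+1 U f -> Ck k U f.
Proof.
elim: k f => [|k IH] f; first by case.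
by case=> cf df; split=> // i; have [dfi /IH] := df i; split.
Qed.

Lemma Ck_subset k U V f : V `<=` U -> Ck k U f -> Ck k V f.
Proof.
move=> VU; elim: k f => [|k IH] f [cf df]; split=> //; try by move=> x /VU; exact: cf.
by move=> i; have [dfi /IH Dfi] := df i; split=> // x /VU; exact: dfi.
Qed.

Lemma open_near U (P : 'rV[R]_n -> Prop) x : open U -> U x ->
  (forall y, U y -> P y) -> \forall y \near x, P y.
Proof. by move=> oU Ux H; apply: filterS H _; exact: open_nbhs_nbhs. Qed.

Lemma Ck_ext k U f g : open U -> (forall x, U x -> f x = g x) -> Ck k U f -> Ck k U g.
Proof.
move=> oU; elim: k f g => [|k IH] f g fg [cf df].
  split=> // x Ux; have := cf x Ux; apply: near_continuous (open_near oU Ux fg).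
split=> [x Ux|i].
  have := cf x Ux; apply: near_continuous (open_near oU Ux fg).
have [dfi Dfi] := df i; split=> [x Ux|].
  by apply: near_eq_derivable (dfi x Ux); exact: (open_near oU Ux fg).
apply: IH Dfi => x Ux; apply: near_eq_derive; exact: (open_near oU Ux fg).
Qed.

Lemma CkD k U f g : open U -> Ck k U f -> Ck k U g -> Ck k U (fun x => f x + g x).
Proof.
move=> oU; elim: k f g => [|k IH] f g [cf df] [cg dg]; split => //.
- by move=> x Ux; apply: continuousD; [exact: cf|exact: cg].
- by move=> x Ux; apply: continuousD; [exact: cf|exact: cg].
move=> i; have [dfi Dfi] := df i; have [dgi Dgi] := dg i; split=> [x Ux|].
  by apply: derivableD; [exact: dfi|exact: dgi].
apply: Ck_ext (IH _ _ Dfi Dgi) => // x Ux; rewrite [RHS]deriveD //; [exact: dfi|exact: dgi].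
Qed.

Lemma CkM k U f g : open U -> Ck k U f -> Ck k U g -> Ck k U (fun x => f x * g x).
Proof.
move=> oU; elim: k f g => [|k IH] f g Cf Cg; have [cf df] := Cf; have [cg dg] := Cg; split => //.
- by move=> x Ux; apply: continuousM; [exact: cf|exact: cg].
- by move=> x Ux; apply: continuousM; [exact: cf|exact: cg].
move=> i; have [dfi Dfi] := df i; have [dgi Dgi] := dg i; split=> [x Ux|].
  by apply: derivableM; [exact: dfi|exact: dgi].
apply: Ck_ext (CkD oU (IH _ _ (CkS Cf) Dgi) (IH _ _ (CkS Cg) Dfi)) => // x Ux.
by rewrite [RHS]deriveM //; [exact: dfi|exact: dgi].
Qed.

Lemma Ck_cst k U (c : R) : Ck k U (fun=> c).
Proof.
elim: k c => [|k IH] c; split => //; try by move=> x _; exact: cst_continuous.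
move=> i.
split=> [x _|]; first exact: derivable_cst.
have -> : (fun x : 'rV[R]_n => 'D_(delta_mx 0 i) (fun=> c) x) = fun=> 0.
  by apply/funext => x; rewrite derive_cst.
exact: IH.
Qed.

Lemma Ck_sum k U (I : Type) (r : seq I) (F : I -> 'rV[R]_n -> R) : open U ->
  (forall i, Ck k U (F i)) -> Ck k U (fun x => \sum_(i <- r) F i x).
Proof.
move=> oU HF; elim: r => [|i r IH].
  by apply: Ck_ext (Ck_cst k U 0) => // x _; rewrite big_nil.
by apply: Ck_ext (CkD oU (HF i) IH) => // x _; rewrite big_cons.
Qed.

Lemma Ck_coord k U j : Ck k U (fun x => x 0 j).
Proof.
have dj x v : is_derive x v (fun x : 'rV[R]_n => x 0 j : R^o) (v 0 j).
  have I : derivable (@id 'rV[R]_n) x v by exact: derivable_id.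
  have H := (derivable_mxP _ _ _).1 I 0 j.
  apply: DeriveDef => //.
  have := derive_mx I; rewrite derive_id => /rowP/(_ j).
  by rewrite mxE => ->.
case: k => [|k]; split => //; try by move=> x _; exact: (@coord_continuous _ 1 n 0 j).
move=> i.
split=> [x _|]; first by have [] := dj x (delta_mx 0 i).
have -> : (fun x : 'rV[R]_n => 'D_(delta_mx 0 i) (fun y : 'rV[R]_n => y 0 j) x) =
    fun=> (delta_mx 0 i : 'rV[R]_n) 0 j.
  by apply/funext => x; have [_ ->] := dj x (delta_mx 0 i).
exact: Ck_cst.
Qed.

(** The mean value theorem between 0 and [h] for [h] of either sign or zero, as needed for arbitrary
    coordinate increments. *)
Lemma MVT_sym (phi dphi : R -> R) (h : R) :
  (forall t : R, `|t| <= `|h| -> is_derive t (1 : R) phi (dphi t)) ->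
  exists2 c, `|c| <= `|h| & phi h - phi 0 = dphi c * h.
Proof.
move=> dp.
have cp (a b : R) : `|a| <= `|h| -> `|b| <= `|h| -> {within `[a, b], continuous phi}.
  move=> ha hb; apply: derivable_within_continuous => t tab.
  have /dp[] // : `|t| <= `|h|.
  move: tab; rewrite in_itv /= => /andP[at1 tb].
  by move: ha hb; rewrite !ler_norml => /andP[? ?] /andP[? ?]; apply/andP; split; lra.
have [h0|h0|h0] := ltgtP h 0.
- have [t||t tI E] := @MVT R phi dphi h 0 h0; last 1 first.
  + exists t; last by rewrite -[phi h - _]opprB E; ring.
    by move: tI; rewrite in_itv /= => /andP[? ?]; rewrite !ltr0_norm //; lra.
  + move=> tI; apply: dp.
    by move: tI; rewrite in_itv /= => /andP[? ?]; rewrite !ltr0_norm //; lra.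
  + by apply: cp; rewrite ?normr0.
- have [t||t tI E] := @MVT R phi dphi 0 h h0; last 1 first.
  + exists t; last by rewrite E; ring.
    by move: tI; rewrite in_itv /= => /andP[? ?]; rewrite !gtr0_norm //; lra.
  + move=> tI; apply: dp.
    by move: tI; rewrite in_itv /= => /andP[? ?]; rewrite !gtr0_norm //; lra.
  + by apply: cp; rewrite ?normr0.
- by exists 0; rewrite h0 ?normr0 // subrr mulr0.
Qed.

Lemma normr_coord_le (v : 'rV[R]_n) i : `|v 0 i| <= `|v|.
Proof. by rewrite [leRHS]/Num.Def.normr /= mx_normrE (le_bigmax _ _ (ord0, i)). Qed.

Lemma normr_row_le (v : 'rV[R]_n) (a : R) : 0 <= a -> (forall i, `|v 0 i| <= a) -> `|v| <= a.
Proof.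
move=> a0 H; rewrite /Num.Def.normr /= mx_normrE; apply: bigmax_le => //= -[i j] _.
by rewrite ord1.
Qed.

Lemma is_derive_line f (p v : 'rV[R]_n) (t : R) : derivable f (t *: v + p) v ->
  is_derive t (1 : R) (fun s : R => f (s *: v + p)) ('D_v f (t *: v + p)).
Proof.
move=> df.
have E : (fun h : R => h^-1 *: (((fun s : R => f (s *: v + p)) \o shift t) (h *: (1 : R)) - f (t *: v + p))) =
   (fun h : R => h^-1 *: ((f \o shift (t *: v + p)) (h *: v) - f (t *: v + p))).
  by apply/funext => h /=; rewrite scalerDl addrA [h *: 1]mulr1.
by apply: DeriveDef; rewrite /derivable /derive E.
Qed.

(* A C^1 function is differentiable: move from [x] to [x + h] one coordinate at
   a time. *)
Lemma C1_differentiable U f x : open U -> Ck 1 U f -> U x -> differentiable f x.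
Proof.
move=> oU [_ C1f] Ux.
pose c i := 'D_(delta_mx 0 i) f x.
have [df dfE] : exists df : {linear 'rV[R]_n -> R^o}, forall v, df v = \sum_i v 0 i * c i.
  pose F (v : 'rV[R]_n) : R^o := \sum_i v 0 i * c i.
  have lin : linear F.
    move=> a u v; rewrite /F scaler_sumr -big_split /=; apply: eq_bigr => i _.
    by rewrite !mxE mulrDl -mulrA.
  pose FM := GRing.isLinear.Build _ _ _ _ F lin.
  by pose FL : {linear 'rV[R]_n -> R^o} := HB.pack F FM; exists FL.
have dfc : continuous df.
  move=> v; rewrite (_ : (df : _ -> _) = fun v => \sum_i v 0 i * c i); last exact/funext.
  apply: (@Ck_continuous 0 setT) => //; apply: Ck_sum => [|i]; first exact: openT.
  by apply: CkM; [exact: openT|exact: Ck_coord|exact: Ck_cst].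
suff H : (f : _ -> R^o) \o shift x = cst (f x : R^o) + df +o_ (0 : 'rV[R]_n) id.
  by apply/diff_locallyP; rewrite (diff_unique dfc H).
apply/eqaddoP => e e0.
(* One share for each of the [n] coordinate steps; [n.+1] keeps the divisor nonzero in dimension
   0. *)
have e1 : 0 < e / n.+1%:R by rewrite divr_gt0.
have : \forall y \near x, U y /\ forall j, `|'D_(delta_mx 0 j) f y - c j| <= e / n.+1%:R.
  near=> y; split; first by near: y; exact: open_nbhs_nbhs.
  move=> j; move: j; near: y; apply: filter_forall => j.
  have [_ [cj _]] := C1f j.
  have /cvgrPdist_le/(_ _ e1) := cj x Ux.
  by apply: filterS => y; rewrite distrC.
move=> /nbhs_ballP[d /= d0 dU].
apply/nbhs_ballP; exists d => //= h.
rewrite -ball_normE /= sub0r normrN => hd.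
rewrite -[(_ - _) h]/(f (h + x) - (f x + df h)).
(* The vertices of the path from 0 to [h]: the first [j] coordinates have been moved. In the sup
   norm the path stays within [|h|] of 0. *)
pose tr j : 'rV[R]_n := \row_i (if (i < j)%N then h 0 i else 0).
have tr0 : tr 0%N = 0 by apply/rowP => i; rewrite !mxE ltn0.
have trn : tr n = h by apply/rowP => i; rewrite !mxE ltn_ord.
have trS (j : 'I_n) : tr j.+1 = h 0 j *: delta_mx 0 j + tr j.
  apply/rowP => i; rewrite !mxE eqxx /= ltnS leq_eqVlt -val_eqE /=.
  by case: (ltngtP i j) => //= [_|_|/val_inj ->]; rewrite ?mulr0 ?mulr1 ?addr0 ?add0r.
have step (j : 'I_n) : exists2 y, ball x d y & f (tr j.+1 + x) - f (tr j + x) = 'D_(delta_mx 0 j) f y * h 0 j.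
  have inb t : `|t| <= `|h 0 j| -> ball x d (t *: delta_mx 0 j + (tr j + x)).
    move=> th; rewrite -ball_normE /= addrA opprD addrCA subrr addr0 normrN.
    apply: le_lt_trans hd; apply: normr_row_le => // i; rewrite !mxE eqxx /=.
    have hi := normr_coord_le h i; case: eqP => [->|_] /=; last first.
      by rewrite mulr0 add0r; case: ifP => // _; rewrite normr0.
    by rewrite ltnn addr0 mulr1; apply: le_trans th (normr_coord_le _ _).
  have [t th|t th E] := @MVT_sym (fun s => f (s *: delta_mx 0 j + (tr j + x)))
     (fun s => 'D_(delta_mx 0 j) f (s *: delta_mx 0 j + (tr j + x))) (h 0 j).
    by apply: is_derive_line; have [H _] := C1f j; apply: H; have [] := dU _ (inb _ th).
  exists (t *: delta_mx 0 j + (tr j + x)); first exact: inb.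
  by rewrite -E scale0r add0r trS addrA.
have -> : f (h + x) - (f x + df h) =
   \sum_(j < n) (f (tr j.+1 + x) - f (tr j + x) - h 0 j * c j).
  rewrite sumrB -dfE -(big_mkord xpredT (fun j => f (tr j.+1 + x) - f (tr j + x))).
  by rewrite telescope_sumr // trn tr0 add0r; ring.
apply: le_trans (ler_norm_sum _ _ _) _.
apply: (@le_trans _ _ (\sum_(j < n) (e / n.+1%:R * `|h|))).
  apply: ler_sum => j _; have [y /dU[_ /(_ j) yc] ->] := step j.
  rewrite mulrC -mulrBr normrM mulrC ler_pM //; exact: normr_coord_le.
rewrite sumr_const card_ord -mulrnAl ler_wpM2r //.
rewrite -[leLHS]mulr_natr -mulrA ger_pMr // mulrC ler_pdivrMr ?mul1r ?ltr0n //.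
by rewrite ler_nat.
Unshelve. all: by end_near. Qed.

End Ck.

Lemma continuous_row (R : realType) (T : topologicalType) n (f : T -> 'rV[R]_n) x :
  (forall j, {for x, continuous (fun y => f y 0 j)}) -> {for x, continuous f}.
Proof.
move=> cf; apply/cvgrPdist_le => e e0; near=> y.
apply: normr_row_le (ltW e0) _ => j; rewrite !mxE.
move: j; near: y; apply: filter_forall => j.
by have /cvgrPdist_le/(_ _ e0) := cf j.
Unshelve. all: by end_near. Qed.

(** The chain rule, available through [C1_differentiable], writes a partial derivative of the
    composite as a sum of products: derivatives of [g] composed with [f], covered by induction,
    times derivatives of [f]. *)
Lemma Ck_comp (R : realType) n m k (U : set 'rV[R]_n) (V : set 'rV[R]_m)
    (f : 'rV[R]_n -> 'rV[R]_m) (g : 'rV[R]_m -> R) :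
  open U -> open V -> (forall x, U x -> V (f x)) ->
  (forall j, Ck k U (fun x => f x 0 j)) -> Ck k V g -> Ck k U (fun x => g (f x)).
Proof.
move=> oU oV UV; elim: k g => [|k IH] g Cf Cg.
  split=> // x Ux; apply: (@continuous_comp _ _ _ f g).
    by apply: continuous_row => j; apply: Ck_continuous (Cf j) _ Ux.
  exact: Ck_continuous Cg _ (UV _ Ux).
have C1 (N : nat) (W : set 'rV[R]_N) h : Ck k.+1 W h -> Ck 1 W h.
  by case=> ch dh; split=> // i; have [dhi Dhi] := dh i; split=> //; split=> //; apply: Ck_continuous Dhi.
have df x : U x -> differentiable f x.
  move=> Ux.
  rewrite (_ : f = \sum_(j < m) (fun y => f y 0 j *: (delta_mx 0 j : 'rV[R]_m))); last first.
    by apply/funext => y; rewrite fct_sumE -row_sum_delta.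
  apply: differentiable_sum => j; apply: differentiableZl.
  exact: C1_differentiable oU (C1 _ _ _ (Cf j)) Ux.
have dg y : V y -> differentiable g y by exact: C1_differentiable oV (C1 _ _ _ Cg).
split=> [x Ux|i].
  by apply: (@continuous_comp _ _ _ f g); apply: differentiable_continuous; [exact: df|exact/dg/UV].
split=> [x Ux|].
  by apply: diff_derivable; apply: (@differentiable_comp _ _ _ _ f g); [exact: df|exact/dg/UV].
pose F j x := 'D_(delta_mx 0 i) (fun x => f x 0 j) x * 'D_(delta_mx 0 j) g (f x).
apply: (@Ck_ext _ _ k U (fun x => \sum_j F j x)) => // [x Ux|].
  have dfx := df x Ux; have dgx := dg _ (UV _ Ux).
  rewrite [RHS]deriveE; last exact: (@differentiable_comp _ _ _ _ f g).
  rewrite (@diff_comp _ _ _ _ f g) //= -(@deriveE _ _ _ f x _ dfx).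
  have dfi := @diff_derivable _ _ _ f x (delta_mx 0 i) dfx.
  rewrite (derive_mx dfi); set w := \matrix_(_, _) _.
  rewrite [w]row_sum_delta.
  rewrite linear_sum; apply: eq_bigr => j _; rewrite linearZ /= -deriveE //.
  by rewrite /F mxE.
apply: Ck_sum => // j; apply: CkM => //.
  by have [_ /(_ i)[]] := Cf j.
apply: (IH (fun y => 'D_(delta_mx 0 j) g y)); first by move=> j'; exact/CkS.
by have [_ /(_ j)[]] := Cg.
Qed.

Lemma Ck_onP (R : realType) n m k (U : set 'rV[R]_n) (f : 'rV[R]_n -> 'rV[R]_m) :
  open U -> (Ck_on k U f <-> forall j, Ck k U (fun x => f x 0 j)).
Proof.
move=> oU; elim: k f => [|k IH] f.
  split=> [[cf _] j|H]; split=> // x Ux.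
    apply: (@continuous_comp _ _ _ f (fun y : 'rV[R]_m => y 0 j)); first exact: cf.
    exact: coord_continuous.
  by apply: continuous_row => j; apply: Ck_continuous (H j) _ Ux.
have ext i j : (forall x, U x -> derivable f x (delta_mx 0 i)) ->
    forall x, U x -> 'D_(delta_mx 0 i) f x 0 j = 'D_(delta_mx 0 i) (fun y => f y 0 j) x.
  by move=> H x Ux; rewrite derive_mx ?mxE //; exact: H.
split=> [[cf df] j|H].
  split=> [x Ux|i].
    apply: (@continuous_comp _ _ _ f (fun y : 'rV[R]_m => y 0 j)); first exact: cf.
    exact: coord_continuous.
  have [dfi Dfi] := df i; split=> [x Ux|].
    exact: (derivable_mxP _ _ _).1 (dfi x Ux) 0 j.
  by apply: Ck_ext ((IH _).1 Dfi j) => // x Ux; exact: ext.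
split=> [x Ux|i].
  by apply: continuous_row => j; apply: Ck_continuous (H j) _ Ux.
have dfi : forall x, U x -> derivable f x (delta_mx 0 i).
  move=> x Ux; apply/derivable_mxP => i0 j; rewrite ord1.
  by have [_ /(_ i)[]] := H j => + _; apply.
split=> //; apply/IH => j.
have [_ /(_ i)[_ Dj]] := H j.
by apply: Ck_ext Dj => // x Ux; rewrite ext.
Qed.

Lemma smooth_on_comp (R : realType) n m p (U : set 'rV[R]_n) (V : set 'rV[R]_m)
    (f : 'rV[R]_n -> 'rV[R]_m) (g : 'rV[R]_m -> 'rV[R]_p) :
  open U -> open V -> (forall x, U x -> V (f x)) ->
  smooth_on U f -> smooth_on V g -> smooth_on U (g \o f).
Proof.
move=> oU oV UV sf sg k; apply/Ck_onP => // j.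
apply: (Ck_comp oU oV UV (g := fun y => g y 0 j)); first exact/Ck_onP.
exact: (Ck_onP _ _ oV).1 (sg k) j.
Qed.

Lemma smooth_onP (R : realType) n m (U : set 'rV[R]_n) (f : 'rV[R]_n -> 'rV[R]_m) :
  open U -> (smooth_on U f <-> forall k j, Ck k U (fun x => f x 0 j)).
Proof. by move=> oU; split=> H k; apply/(Ck_onP _ _ oU). Qed.

Lemma smooth_on_continuous (R : realType) n m (U : set 'rV[R]_n) (f : 'rV[R]_n -> 'rV[R]_m) x :
  smooth_on U f -> U x -> {for x, continuous f}.
Proof. by move=> sf Ux; have [cf _] := sf 0%N; exact: cf. Qed.

Lemma smooth_on_subset (R : realType) n m (U V : set 'rV[R]_n) (f : 'rV[R]_n -> 'rV[R]_m) :
  open U -> open V -> V `<=` U -> smooth_on U f -> smooth_on V f.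
Proof.
move=> oU oV VU /(smooth_onP _ oU) sf; apply/(smooth_onP _ oV) => k j.
exact: Ck_subset VU (sf k j).
Qed.

Lemma smooth_on_affine (R : realType) n m (U : set 'rV[R]_n)
    (M : 'M[R]_(n, m)) (c : 'rV[R]_m) :
  open U -> smooth_on U (fun x => x *m M + c).
Proof.
move=> oU; apply/smooth_onP => // k j.
apply: (@Ck_ext _ _ _ _ (fun x => \sum_i x 0 i * M i j + c 0 j)) => // [x _|].
  by rewrite !mxE.
apply: CkD => //; last exact: Ck_cst.
by apply: Ck_sum => // i; apply: CkM => //; [exact: Ck_coord|exact: Ck_cst].
Qed.

(** What composing smooth maps needs of the middle space. It passes directly to products, so
    [prod_space] need not be shown to be a manifold. *)
Definition covered (R : realType) (X : atlas_space R) : Prop :=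
  (forall c, atlas X c -> open c.1) /\
  forall p : X, exists2 c, atlas X c & (c.2 @` c.1) p.

Lemma smooth_manifold_covered (R : realType) (X : atlas_space R) :
  smooth_manifold X -> covered X.
Proof. by case. Qed.

Lemma open_preimage_in (T S : topologicalType) (W : set T) (V : set S) (h : T -> S) :
  open W -> open V -> (forall x, W x -> {for x, continuous h}) ->
  open (W `&` h @^-1` V).
Proof.
move=> oW oV ch; rewrite openE => x [Wx Vhx]; apply: filterI.
  exact: open_nbhs_nbhs.
by apply: (ch x Wx); exact: open_nbhs_nbhs.
Qed.

Lemma smooth_map_comp (R : realType) (X Y Z : atlas_space R) (f : X -> Y) (g : Y -> Z) :
  covered Y -> smooth_map f -> smooth_map g -> smooth_map (g \o f).
Proof.
move=> [_ cY] sf sg c e x ac ae cx ex.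
have [d ad dfx] := cY (f (c.2 x)).
have [W [h [oW Wx Wc sh hW]]] := sf c d x ac ad cx dfx.
have [dh fh] := hW x Wx.
have [|W' [h' [oW' Wx' Wc' sh' hW']]] := sg d e (h x) ad ae dh.
  by rewrite -fh.
have ch w : W w -> {for w, continuous h} by exact: smooth_on_continuous.
have oWW : open (W `&` h @^-1` W') by exact: open_preimage_in.
exists (W `&` h @^-1` W'), (h' \o h); split=> //.
- by move=> w [/Wc].
- apply: (smooth_on_comp oWW oW' _ _ sh') => [w []//|].
  exact: smooth_on_subset oW oWW (@subIsetl _ _ _) sh.
- by move=> w [/hW[_ E] /hW'[? E']] /=; split=> //; rewrite E.
Qed.

Lemma diffeomorphic_sym (R : realType) (X Y : atlas_space R) :
  diffeomorphic X Y -> diffeomorphic Y X.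
Proof. by case=> f [g [fK gK sf sg]]; exists g, f. Qed.

Lemma diffeomorphic_trans (R : realType) (X Y Z : atlas_space R) :
  covered Y -> diffeomorphic X Y -> diffeomorphic Y Z -> diffeomorphic X Z.
Proof.
move=> cY [f [g [fK gK sf sg]]] [f' [g' [fK' gK' sf' sg']]].
exists (f' \o f), (g \o g'); split; [exact: can_comp|exact: can_comp| |];
  exact: smooth_map_comp.
Qed.

(** * Products of atlas spaces *)

Section Prod.
Context {R : realType}.
Import tagnat.

Lemma Ck_submxrow k n (d : 'I_k -> nat) (U : set 'rV[R]_(\sum_i d i)) i b :
  Ck n U (fun x => submxrow x i 0 b).
Proof.
rewrite (_ : (fun x => _) = fun x : 'rV[R]__ => x 0 (Rank i b)); first exact: Ck_coord.
by apply/funext => x; rewrite mxE.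
Qed.

Lemma submxrow_continuous k (d : 'I_k -> nat) i :
  continuous (fun x : 'rV[R]_(\sum_i d i) => submxrow x i).
Proof.
move=> x; apply: continuous_row => b.
by apply: (@Ck_continuous _ _ 0 setT) => //; exact: Ck_submxrow.
Qed.

Lemma open_box k (d : 'I_k -> nat) (W : forall i, set 'rV[R]_(d i)) :
  (forall i, open (W i)) -> open [set x : 'rV[R]_(\sum_i d i) | forall i, W i (submxrow x i)].
Proof.
move=> oW; rewrite openE => x Wx.
suff : \forall y \near x, forall i, W i (submxrow y i) by [].
apply: (@filter_forall _ _ (fun i y => W i (submxrow y i)) (nbhs x) _) => i.
by apply: (@submxrow_continuous _ _ i x); exact: open_nbhs_nbhs.
Qed.

Lemma smooth_on_mxrow k (d e : 'I_k -> nat) (W : forall i, set 'rV[R]_(d i))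
    (g : forall i, 'rV[R]_(d i) -> 'rV[R]_(e i)) :
  (forall i, open (W i)) -> (forall i, smooth_on (W i) (@g i)) ->
  smooth_on [set x : 'rV[R]_(\sum_i d i) | forall i, W i (submxrow x i)]
    (fun x => \mxrow_i g i (submxrow x i)).
Proof.
move=> oW sg; apply/smooth_onP; first exact: open_box.
move=> n j; apply: (@Ck_ext _ _ _ _ (fun x => g (sig1 j) (submxrow x (sig1 j)) 0 (sig2 j))).
- exact: open_box.
- by move=> x _; rewrite mxE.
apply: (@Ck_comp _ _ _ _ _ (W (sig1 j)) (fun x => submxrow x (sig1 j)) (fun y => g (sig1 j) y 0 (sig2 j))) => //.
- exact: open_box.
- by move=> b; exact: Ck_submxrow.
- exact: (smooth_onP _ (oW _)).1 (sg _) n _.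
Qed.

Lemma prod_covered k (M : 'I_k -> atlas_space R) :
  (forall i, covered (M i)) -> covered (prod_space M).
Proof.
move=> cM; split=> [c [d ad ->]|p] /=.
  by apply: (open_box (W := fun i => (d i).1)) => i; have [+ _] := cM i; apply.
have H i : {d | atlas (M i) d /\ (d.2 @` d.1) (p i)}.
  by apply: cid; have [_ /(_ (p i))[d]] := cM i; exists d.
have G i : {x | (sval (H i)).1 x /\ (sval (H i)).2 x = p i}.
  by apply: cid; have [_ [x]] := svalP (H i); exists x.
pose x := \mxrow_i (sval (G i)).
exists ([set y | forall i, (sval (H i)).1 (submxrow y i)],
   fun y i => (sval (H i)).2 (submxrow y i)).
  by exists (fun i => sval (H i)) => // i; have [] := svalP (H i).
exists x => [i|] /=; first by rewrite mxrowK; have [] := svalP (G i).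
by apply: functional_extensionality_dep => i; rewrite mxrowK; have [] := svalP (G i).
Qed.

Lemma diffeomorphic_prod k (M N : 'I_k -> atlas_space R) :
  (forall i, diffeomorphic (M i) (N i)) -> diffeomorphic (prod_space M) (prod_space N).
Proof.
have smooth_prod (X Y : 'I_k -> atlas_space R) (f : forall i, X i -> Y i) :
    (forall i, smooth_map (@f i)) ->
    @smooth_map _ (prod_space X) (prod_space Y) (fun x i => f i (x i)).
  move=> sf c e x [c' ac ->] [e' ae ->] /= cx [y ey yE].
  have H i : {Wg : set 'rV[R]_(Defs.dim (X i)) * ('rV[R]_(Defs.dim (X i)) -> 'rV[R]_(Defs.dim (Y i))) |
     [/\ open Wg.1, Wg.1 (submxrow x i), Wg.1 `<=` (c' i).1, smooth_on Wg.1 Wg.2 &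
       forall w, Wg.1 w -> (e' i).1 (Wg.2 w) /\ f i ((c' i).2 w) = (e' i).2 (Wg.2 w)]}.
    apply: cid; have [|W [g HW]] := sf i (c' i) (e' i) _ (ac i) (ae i) (cx i).
      by exists (submxrow y i) => //; exact: (congr1 (fun p => p i) yE).
    by exists (W, g).
  exists [set x | forall i, (sval (H i)).1 (submxrow x i)],
    (fun x => \mxrow_i (sval (H i)).2 (submxrow x i)); split=> /=.
  - by apply: (open_box (W := fun i => (sval (H i)).1)) => i; have [] := svalP (H i).
  - by move=> i; have [] := svalP (H i).
  - by move=> z Wz i; have [_ _ + _ _] := svalP (H i); apply; exact: Wz.
  - apply: (smooth_on_mxrow (W := fun i => (sval (H i)).1) (g := fun i => (sval (H i)).2)) => i;
      by have [] := svalP (H i).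
  - move=> w Ww; split=> [i|].
      by rewrite mxrowK; have [_ _ _ _ /(_ _ (Ww i))[]] := svalP (H i).
    apply: functional_extensionality_dep => i.
    by rewrite mxrowK; have [_ _ _ _ /(_ _ (Ww i))[]] := svalP (H i).
move=> MN.
have H i : {fg : (M i -> N i) * (N i -> M i) |
    [/\ cancel fg.1 fg.2, cancel fg.2 fg.1, smooth_map fg.1 & smooth_map fg.2]}.
  by apply: cid; have [f [g fgP]] := MN i; exists (f, g).
exists (fun x i => (sval (H i)).1 (x i)), (fun x i => (sval (H i)).2 (x i)); split.
- by move=> x; apply: functional_extensionality_dep => i; have [-> _ _ _] := svalP (H i).
- by move=> x; apply: functional_extensionality_dep => i; have [_ -> _ _] := svalP (H i).
- by apply: (smooth_prod M N (fun i => (sval (H i)).1)) => i; have [] := svalP (H i).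
- by apply: (smooth_prod N M (fun i => (sval (H i)).2)) => i; have [] := svalP (H i).
Qed.

End Prod.

(** * The smooth manifold M(A) *)

Section Act.
Context {R : realType}.

Definition act n (A : 'M['F_2]_n) (v : 'rV[int]_n) (t : 'rV[R]_n) : 'rV[R]_n :=
  \row_j (sgF R ((mod2 v *m A) 0 j) * t 0 j + pi * (v 0 j)%:~R).

Lemma act_gmul n (A : 'M['F_2]_n) v w t : act A v (act A w t) = act A (gmul A v w) t.
Proof.
apply/rowP => j; rewrite [RHS]mxE mod2_gmul mulmxDl [(_ + _ : 'M[_]_(_, _)) _ _]mxE sgFD.
rewrite [gmul _ _ _ _ _]mxE rmorphD rmorphM /= sgF_intr.
by rewrite mxE [act A w t 0 j]mxE; ring.
Qed.

Lemma act_even n (A : 'M['F_2]_n) u t : act A (u *+ 2) t = t + \row_j (pi * 2 * (u 0 j)%:~R).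
Proof.
apply/rowP => j; rewrite mxE mod2_even mul0mx [(0 : 'M[_]_(_, _)) _ _]mxE sgF0 mulmxnE.
by rewrite [RHS]mxE [(\row_(_ < _) _) _ _]mxE mul1r mulr2n rmorphD /=; ring.
Qed.

Lemma act0 n (A : 'M['F_2]_n) t : act A 0 t = t.
Proof.
have := act_even A 0 t; rewrite mul0rn => ->.
by rewrite (_ : \row_(_ < _) _ = 0) ?addr0 //; apply/rowP => j; rewrite !mxE mulr0.
Qed.

Definition ginv n (A : 'M['F_2]_n) (v : 'rV[int]_n) : 'rV[int]_n :=
  \row_j (- (sgF int ((mod2 v *m A) 0 j) * v 0 j)).

Lemma mod2_ginv n (A : 'M['F_2]_n) v : mod2 (ginv A v) = mod2 v.
Proof. by apply/rowP => j; rewrite mxE [ginv _ _ _ _]mxE rmorphN rmorphM /= sgF_intr sgF_F2 mul1r F2_opp mxE. Qed.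

Lemma gmulVg n (A : 'M['F_2]_n) v : gmul A (ginv A v) v = 0.
Proof. by apply/rowP => j; rewrite mxE mod2_ginv [ginv _ _ _ _]mxE addNr mxE. Qed.

Lemma actK n (A : 'M['F_2]_n) v : cancel (act A v) (act A (ginv A v)).
Proof. by move=> t; rewrite act_gmul gmulVg act0. Qed.

(* At the first coordinate where [v] and [w] differ the signs agree. *)
Lemma act_discrete n (A : 'M['F_2]_n) v w t : bott_matrix A ->
  `|act A v t - act A w t| < 1 -> v = w.
Proof.
move=> bA d; apply/rowP => -[]; elim/ltn_ind => i IH il; set j := Ordinal il.
have E : (mod2 v *m A) 0 j = (mod2 w *m A) 0 j.
  rewrite !mxE; apply: eq_bigr => k _; have [kj|jk] := ltnP k j.
    by rewrite !mxE; have := IH k kj (ltn_ord k); rewrite (_ : Ordinal _ = k) => [-> //|]; exact: val_inj.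
  by rewrite bA // !mulr0.
have := le_lt_trans (normr_coord_le _ j) d.
rewrite mxE [act A v t _ _]mxE [(- _ : 'M[_]_(_, _)) _ _]mxE [act A w t _ _]mxE E.
rewrite opprD addrACA subrr add0r -mulrBr -rmorphB normrM gtr0_norm ?pi_gt0 //= => H.
apply/eqP; rewrite -subr_eq0; apply: contraTT H => vw; rewrite -leNgt.
rewrite -[leLHS]mulr1; apply: ler_pM => //; first by apply: le_trans (pi_ge2 R); rewrite ler1n.
by rewrite -intr_norm -[1]/(1%:~R) ler_int; move: vw; case: (_ - _) => [[|m]|m].
Qed.

Lemma act_inj n (A : 'M['F_2]_n) v w t : bott_matrix A -> act A v t = act A w t -> v = w.
Proof. by move=> bA E; apply: (act_discrete (t := t) bA); rewrite E subrr normr0. Qed.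

Lemma trig_2pi (x : R) (k : int) :
  cos (x + pi * 2 * k%:~R) = cos x /\ sin (x + pi * 2 * k%:~R) = sin x.
Proof.
have P (m : nat) (y : R) : cos (y + pi * 2 * m%:R) = cos y /\ sin (y + pi * 2 * m%:R) = sin y.
  rewrite !mulr_natr; split.
    exact: (periodicn (@cosD2pi R)).
  exact: (periodicn (@sinD2pi R)).
case: k => m; first exact: P.
have [c1 s1] := P m.+1 (x + pi * 2 * (Negz m)%:~R).
have E : x + pi * 2 * (Negz m)%:~R + pi * 2 * m.+1%:R = x.
  by rewrite NegzE mulrNz -[m.+1%:~R]/(m.+1%:R); ring.
by rewrite E in c1 s1; rewrite -c1 -s1.
Qed.

(** Reduce modulo 2 pi to y in [0, 2 pi[. Cosine is injective on [0, pi], which is applied to y or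
    to 2 pi - y. *)
Lemma cos_eq1 (x : R) : cos x = 1 -> exists k : int, x = pi * 2 * k%:~R.
Proof.
move=> cx; have p0 : 0 < pi :> R := pi_gt0 R.
pose k := Num.floor (x / (pi * 2)); exists k.
pose y := x - pi * 2 * k%:~R.
have cy : cos y = 1 by rewrite -cx /y -mulrN -rmorphN; have [] := trig_2pi x (- k).
have y0 : 0 <= y.
  by rewrite subr_ge0 mulrC -ler_pdivlMr ?mulr_gt0 //; exact: floor_le.
have y1 : y < pi * 2.
  rewrite ltrBlDl -[X in _ + X]mulr1 -mulrDr mulrC -ltr_pdivrMr ?mulr_gt0 //.
  by have := floorD1_gt (x / (pi * 2)); rewrite rmorphD.
have c0 (z : R) : 0 <= z <= pi -> cos z = 1 -> z = 0.
  by move=> zI cz; apply: cos_inj; rewrite ?in_itv /= ?lexx ?zI ?(ltW p0) // cz cos0.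
have [yp|yp] := leP y pi.
  by apply/eqP; rewrite -subr_eq0 -/y; apply/eqP/c0 => //; rewrite y0 yp.
have E : pi * 2 - y = 0.
  apply: c0; first by apply/andP; split; lra.
  by rewrite addrC -[pi * 2]mulr1 -[1]/(1%:~R); have [-> _] := trig_2pi (- y) 1; rewrite cosN.
by move: y1; rewrite -subr_gt0 E ltxx.
Qed.

Lemma circle_exp_eq n (s t : 'rV[R]_n) : circle_exp s = circle_exp t ->
  exists u : 'rV[int]_n, t = s + \row_j (pi * 2 * (u 0 j)%:~R).
Proof.
move=> E.
have H j : {k : int | t 0 j - s 0 j = pi * 2 * k%:~R}.
  apply: cid; apply: cos_eq1.
  have := congr1 (fun f => f j) E; rewrite /circle_exp => -[cE sE].
  by rewrite cosB cE sE -!expr2 cos2Dsin2.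
exists (\row_j sval (H j)); apply/rowP => j; rewrite !mxE -(svalP (H j)).
by rewrite addrC subrK.
Qed.

Lemma circle_exp_2pi n (s : 'rV[R]_n) (u : 'rV[int]_n) :
  circle_exp (s + \row_j (pi * 2 * (u 0 j)%:~R)) = circle_exp s.
Proof.
apply/funext => j; rewrite /circle_exp !mxE.
by have [-> ->] := trig_2pi (s 0 j) (u 0 j).
Qed.

Lemma circle_exp_gen n (A : 'M['F_2]_n) i (t : 'rV[R]_n) : bott_matrix A ->
  circle_exp (act A (gen i) t) = bott_involution A i (circle_exp t).
Proof.
move=> bA; apply/funext => j; rewrite /circle_exp /bott_involution.
have -> : act A (gen i) t 0 j = sgF R (A i j) * t 0 j + pi * (i == j)%:R.
  by rewrite mxE mod2_gen -row_mul mul1mx mxE [gen _ _ _]mxE [(1%:M : 'M[_]_(_, _)) _ _]mxE; case: (i == j).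
case: ltnP => [ji|ij].
  by rewrite bA ?(ltnW ji) // sgF0 mul1r (_ : i == j = false) ?mulr0 ?addr0 //; apply: gtn_eqF.
case: (j =P i) => [->|/eqP ji].
  by rewrite bA // eqxx sgF0 mul1r mulr1 cosDpi sinDpi.
rewrite eq_sym (negPf ji) mulr0 addr0 /twist.
case: (F2_cases (A i j)) => ->; rewrite ?eqxx ?sgF0 ?sgF1 ?mul1r //=.
by rewrite mulN1r cosN sinN.
Qed.

Lemma orbit_act n (A : 'M['F_2]_n) v (t : 'rV[R]_n) : bott_matrix A ->
  bott_orbit A (circle_exp t) (circle_exp (act A v t)).
Proof.
move=> bA; apply: (gmul_ind bA (P := fun v => bott_orbit A (circle_exp t) (circle_exp (act A v t)))) => [u|k w [s E]].
  by exists [::]; rewrite act_even circle_exp_2pi.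
by exists (k :: s); rewrite -act_gmul circle_exp_gen // E.
Qed.

Lemma orbit_actP n (A : 'M['F_2]_n) (t : 'rV[R]_n) w : bott_matrix A ->
  bott_orbit A (circle_exp t) w -> exists v, w = circle_exp (act A v t).
Proof.
move=> bA [s ->]; elim: s => [|k s [v IH]]; first by exists 0; rewrite act0.
by exists (gmul A (gen k) v); rewrite /= IH -act_gmul circle_exp_gen.
Qed.

Lemma bott_projP n (A : 'M['F_2]_n) (s t : 'rV[R]_n) : bott_matrix A ->
  (bott_proj A s = bott_proj A t <-> exists v, t = act A v s).
Proof.
move=> bA; split=> [E|].
  have : bott_orbit A (circle_exp s) (circle_exp t).
    by rewrite (congr1 sval E : bott_orbit A _ = _); exists [::].
  move=> /(orbit_actP bA)[v /esym/circle_exp_eq[u ->]].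
  by exists (gmul A (u *+ 2) v); rewrite -act_gmul act_even.
move=> [v ->]; apply: eq_exist; apply/seteqP; split=> w /(orbit_actP bA)[v' ->].
  by rewrite -[X in act A v' X](actK A v s) act_gmul; exact: orbit_act.
by rewrite act_gmul; exact: orbit_act.
Qed.

Lemma unit_circle_polar (a b : R) : a ^+ 2 + b ^+ 2 = 1 -> exists x, cos x = a /\ sin x = b.
Proof.
move=> ab; have aI : -1 <= a <= 1.
  by rewrite -ler_norml -(ler_pXn2r (n := 2)) ?nnegrE // expr1n real_normK ?num_real // -ab lerDl sqr_ge0.
have E : Num.sqrt (1 - a ^+ 2) = `|b| by rewrite -ab addrAC subrr add0r sqrtr_sqr.
have [b0|b0] := leP 0 b.
  by exists (acos a); rewrite acosK ?in_itv //= sin_acos // E ger0_norm.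
by exists (- acos a); rewrite cosN acosK ?in_itv //= sinN sin_acos // E ltr0_norm ?opprK.
Qed.

Lemma bott_proj_surj n (A : 'M['F_2]_n) (p : bott_quotient R A) : exists t, bott_proj A t = p.
Proof.
case: p => C [z tz CE].
have H j : {x : R | cos x = complex.Re (z j) /\ sin x = complex.Im (z j)}.
  apply: cid; apply: unit_circle_polar; have := tz j; rewrite normc_def => -[].
  by move=> /(congr1 (fun y => y ^+ 2)); rewrite sqr_sqrtr ?addr_ge0 ?sqr_ge0 // expr1n.
exists (\row_j sval (H j)); apply: eq_exist; rewrite CE; congr bott_orbit.
apply/funext => j; rewrite /circle_exp mxE; have [-> ->] := svalP (H j).
by case: (z j).
Qed.

Lemma bott_descent n (A : 'M['F_2]_n) (Q : Type) (q : 'rV[R]_n -> Q) : bott_matrix A ->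
  (forall v t, q (act A v t) = q t) ->
  exists F : bott_quotient R A -> Q, forall t, F (bott_proj A t) = q t.
Proof.
move=> bA qA; pose rep (p : bott_quotient R A) := sval (cid (bott_proj_surj p)).
exists (fun p => q (rep p)) => t.
by have /(bott_projP _ _ bA)[v {2}->] := svalP (cid (bott_proj_surj (bott_proj A t))).
Qed.

(** Two points of a ball of radius 1/2 are less than 1 apart, too close to differ by a nontrivial
    deck transformation. These balls serve as charts. *)
Lemma bott_proj_inj_ball n (A : 'M['F_2]_n) (t : 'rV[R]_n) : bott_matrix A ->
  {in (ball t (2^-1 : R) : set 'rV[R]_n) &, injective (bott_proj A)}.
Proof.
move=> bA s s'; rewrite !inE -ball_normE /= => sb sb' /(bott_projP _ _ bA)[v E].
suff v0 : v = 0 by rewrite E v0 act0.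
apply: (act_discrete (t := s) bA); rewrite act0 -E.
rewrite -(subrKA t); apply: le_lt_trans (ler_normD _ _) _.
by rewrite (splitr 1) div1r ltrD // distrC.
Qed.

Lemma bott_covered n (A : 'M['F_2]_n) : bott_matrix A -> covered (bott_space R A).
Proof.
move=> bA; split=> [c [] //|p]; have [t <-] := bott_proj_surj p.
exists (ball t (2^-1 : R), bott_proj A).
  by split=> //=; [exact: ball_open|exact: bott_proj_inj_ball].
by exists t => //=; exact: ballxx.
Qed.

Lemma smooth_on_act n (A : 'M['F_2]_n) v : smooth_on setT (act A v).
Proof.
apply/smooth_onP; first exact: openT.
move=> k j; apply: (@Ck_ext _ _ _ _ (fun x => sgF R ((mod2 v *m A) 0 j) * x 0 j + pi * (v 0 j)%:~R)).
- exact: openT.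
- by move=> x _; rewrite [RHS]mxE.
by apply: CkD; [exact: openT| |exact: Ck_cst];
  apply: CkM; [exact: openT|exact: Ck_cst|exact: Ck_coord].
Qed.

(** The chart of the target may contain another lift of the image point than [h x]. A deck
    transformation moves one to the other, and its composite with [h] is the local expression. *)
Lemma bott_map_smooth n m (A : 'M['F_2]_n) (B : 'M['F_2]_m)
    (f : bott_space R A -> bott_space R B) (h : 'rV[R]_n -> 'rV[R]_m) :
  bott_matrix B -> smooth_on setT h ->
  (forall t, f (bott_proj A t) = bott_proj B (h t)) -> smooth_map f.
Proof.
move=> bB sh fh c d x [oc ic cE] [od id dE] cx; rewrite cE fh dE.
move=> [y dy /esym/(bott_projP _ _ bB)[w yE]].
have sg : smooth_on setT (act B w \o h).
  by apply: smooth_on_comp sh (smooth_on_act _ _) => //; exact: openT.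
have oW : open (c.1 `&` (act B w \o h) @^-1` d.1).
  by apply: open_preimage_in => // z _; exact: smooth_on_continuous sg _.
exists (c.1 `&` (act B w \o h) @^-1` d.1), (act B w \o h); split=> //.
- by split=> //=; rewrite -yE.
- exact: smooth_on_subset openT oW _ sg.
- move=> z [cz dz]; split; first exact: dz.
  rewrite fh.
  by apply/(bott_projP _ _ bB); exists w.
Qed.

Lemma bott_diffeomorphic n m (A : 'M['F_2]_n) (B : 'M['F_2]_m)
    (h : 'rV[R]_n -> 'rV[R]_m) (h' : 'rV[R]_m -> 'rV[R]_n) :
  bott_matrix A -> bott_matrix B -> cancel h h' -> cancel h' h ->
  smooth_on setT h -> smooth_on setT h' ->
  (forall v t, exists w, h (act A v t) = act B w (h t)) ->
  (forall w s, exists v, h' (act B w s) = act A v (h' s)) ->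
  diffeomorphic (bott_space R A) (bott_space R B).
Proof.
move=> bA bB hK hK' sh sh' heq heq'.
have [|f fE] := @bott_descent n A _ (fun t => bott_proj B (h t)) bA.
  by move=> v t; apply/esym/(bott_projP _ _ bB); exact: heq.
have [|g gE] := @bott_descent m B _ (fun t => bott_proj A (h' t)) bB.
  by move=> v t; apply/esym/(bott_projP _ _ bA); exact: heq'.
exists f, g; split.
- by move=> p; have [t <-] := bott_proj_surj p; rewrite fE gE hK.
- by move=> p; have [t <-] := bott_proj_surj p; rewrite gE fE hK'.
- exact: bott_map_smooth sh fE.
- exact: bott_map_smooth sh' gE.
Qed.

Section Mxdiag.
Import tagnat.
Context {k : nat} {n_ : 'I_k -> nat} (A_ : forall i, 'M['F_2]_(n_ i)).
Hypothesis bA : forall i, bott_matrix (A_ i).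
Let A := \mxdiag_i A_ i.

Lemma submxrow_act v (t : 'rV[R]_(\sum_i n_ i)) i :
  submxrow (act A v t) i = act (A_ i) (submxrow v i) (submxrow t i).
Proof.
apply/rowP => b; rewrite mxE mxE [RHS]mxE [submxrow t i _ _]mxE [submxrow v i _ _]mxE.
congr (sgF _ _ * _ + _).
have := congr1 (fun w : 'rV['F_2]_(n_ i) => w 0 b) (submxrow_mul (mod2 v) A i).
rewrite /= mxE => ->.
rewrite [X in fun_of_matrix X _ _](bigD1 i) //= [X in _ + X]big1 => [|j ji]; last first.
  suff -> : submxblock A j i = 0 by rewrite mulmx0.
  apply/matrixP => a c; rewrite mxE [RHS]mxE; apply/eqP; apply: contraNT ji => /mxdiag_neq0.
  by rewrite !Rank1K => ->.
rewrite addr0 submxblock_diag; congr ((_ *m _) _ _).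
by apply/rowP => c; rewrite !mxE.
Qed.

(** Both sides are quotients of the same space by the same group, which acts block by block, so the
    local expressions in both directions are deck transformations. *)
Lemma bott_mxdiag_diffeomorphic :
  diffeomorphic (bott_space R A) (prod_space (fun i => bott_space R (A_ i))).
Proof.
have bD : bott_matrix A := bott_mxdiag bA.
pose q (t : 'rV[R]_(\sum_i n_ i)) : prod_space (fun i => bott_space R (A_ i)) :=
  fun i => bott_proj (A_ i) (submxrow t i).
have qP s t : q s = q t <-> exists v, t = act A v s.
  split=> [E|[v ->]]; last first.
    apply: functional_extensionality_dep => i; apply/(bott_projP _ _ (@bA i)).
    by exists (submxrow v i); rewrite submxrow_act.
  have H i : {v | submxrow t i = act (A_ i) v (submxrow s i)}.
    by apply/cid/(bott_projP _ _ (@bA i)); exact: (congr1 (fun p => p i) E).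
  exists (\mxrow_i sval (H i)); rewrite -[LHS]submxrowK -[RHS]submxrowK.
  by apply/eq_mxrow => i; rewrite submxrow_act mxrowK -(svalP (H i)).
have qS p : exists t, q t = p.
  pose H i := cid (bott_proj_surj (p i)); exists (\mxrow_i sval (H i)).
  by apply: functional_extensionality_dep => i; rewrite /q mxrowK (svalP (H i)).
have [|f fE] := @bott_descent _ A _ q bD.
  by move=> v t; apply/esym/qP; exists v.
pose g p := bott_proj A (sval (cid (qS p))).
have gE t : g (q t) = bott_proj A t.
  by apply/(bott_projP _ _ bD)/qP; exact: svalP (cid (qS (q t))).
exists f, g; split.
- by move=> p; have [t <-] := bott_proj_surj p; rewrite fE gE.
- by move=> p; have [t <-] := qS p; rewrite gE fE.
- move=> c e x [oc ic cE] [d dA ->] cx /= [y dy].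
  have dq y' : (fun i => (d i).2 (submxrow y' i)) = q y'.
    by apply: functional_extensionality_dep => i; have [_ _ ->] := dA i.
  rewrite dq cE fE => /esym/qP[v yE].
  have od : open [set y | forall i, (d i).1 (submxrow y i)].
    by apply: (open_box (W := fun i => (d i).1)) => i; have [] := dA i.
  have oW : open (c.1 `&` act A v @^-1` [set y | forall i, (d i).1 (submxrow y i)]).
    by apply: open_preimage_in => // z _; exact: smooth_on_continuous (smooth_on_act _ _) _.
  exists (c.1 `&` act A v @^-1` [set y | forall i, (d i).1 (submxrow y i)]), (act A v); split=> //.
  + by split=> //=; rewrite -yE.
  + exact: smooth_on_subset openT oW _ (smooth_on_act _ _).
  + move=> z [cz dz]; split; first exact: dz.
    rewrite fE dq.
    by apply/qP; exists v.
- move=> e c x [d dA ->] [oc ic cE] /= dx [y cy].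
  have dq y' : (fun i => (d i).2 (submxrow y' i)) = q y'.
    by apply: functional_extensionality_dep => i; have [_ _ ->] := dA i.
  rewrite dq cE gE => /esym/(bott_projP _ _ bD)[v yE].
  have od : open [set y | forall i, (d i).1 (submxrow y i)].
    by apply: (open_box (W := fun i => (d i).1)) => i; have [] := dA i.
  have oW : open ([set y | forall i, (d i).1 (submxrow y i)] `&` act A v @^-1` c.1).
    by apply: open_preimage_in => // z _; exact: smooth_on_continuous (smooth_on_act _ _) _.
  exists ([set y | forall i, (d i).1 (submxrow y i)] `&` act A v @^-1` c.1), (act A v); split=> //.
  + by split=> //=; rewrite -yE.
  + exact: smooth_on_subset openT oW _ (smooth_on_act _ _).
  + move=> z [dz cz]; split; first exact: cz.
    rewrite dq gE.
    by apply/(bott_projP _ _ bD); exists v.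
Qed.

End Mxdiag.

End Act.

(** * The manifold axioms for M(A), and diffeomorphisms from isomorphisms mod 2 *)

Section Manifold.
Context {R : realType}.

Lemma act_isometry n (A : 'M['F_2]_n) v (s t : 'rV[R]_n) :
  `|act A v s - act A v t| <= `|s - t|.
Proof.
apply: normr_row_le => // j; apply: le_trans (normr_coord_le (s - t) j).
rewrite mxE [(- _ : 'M[_]_(_, _)) _ _]mxE [act _ _ s _ _]mxE [act _ _ t _ _]mxE.
rewrite [(s - t) _ _]mxE [(- t) _ _]mxE opprD addrACA subrr addr0 -mulrBr normrM.
by case: (F2_cases ((mod2 v *m A) 0 j)) => ->; rewrite ?sgF0 ?sgF1 ?normrN normr1 mul1r.
Qed.

(* By [act_discrete] at most one translate of [s] is within [1/2] of [t]. *)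
Lemma orbit_separated n (A : 'M['F_2]_n) (s t : 'rV[R]_n) : bott_matrix A ->
  (forall v, t <> act A v s) ->
  exists2 r : R, 0 < r & forall v, r + r <= `|act A v s - t|.
Proof.
move=> bA ts.
have [[v0 v0P]|H] := pselect (exists v0, `|act A v0 s - t| < 2^-1); last first.
  exists (4^-1); first by rewrite invr_gt0.
  move=> v; rewrite leNgt; apply/negP => Hv; apply: H; exists v; apply: lt_le_trans Hv _; lra.
have d0 : 0 < `|act A v0 s - t|.
  by rewrite normr_gt0 subr_eq0; apply/eqP => E; exact: ts (esym E).
exists (`|act A v0 s - t| / 2); first by rewrite divr_gt0.
move=> v; rewrite -splitr leNgt; apply/negP => Hv.
suff E : v = v0 by rewrite E ltxx in Hv.
apply: (act_discrete (t := s) bA); rewrite -(subrKA t).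
apply: le_lt_trans (ler_normD _ _) _; rewrite [X in _ + X]distrC.
by move: v0P (lt_trans Hv v0P) => ? ?; lra.
Qed.

Lemma bott_atlas_open n (A : 'M['F_2]_n) (U : set 'rV[R]_n) : bott_matrix A -> open U ->
  @atlas_open _ (bott_space R A) (bott_proj A @` U).
Proof.
move=> bA oU c [oc _ ->]; rewrite openE => x [cx [a Ua /esym/(bott_projP _ _ bA)[v aE]]].
have oW : open (c.1 `&` act A v @^-1` U).
  by apply: open_preimage_in => // z _; exact: smooth_on_continuous (smooth_on_act _ _) _.
suff : nbhs x (c.1 `&` act A v @^-1` U).
  apply: filterS => z [cz Uz]; split=> //; exists (act A v z) => //.
  by apply/esym/(bott_projP _ _ bA); exists v.
by apply: open_nbhs_nbhs; split=> //; split=> //=; rewrite -aE.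
Qed.

Lemma bott_smooth_manifold n (A : 'M['F_2]_n) : bott_matrix A -> smooth_manifold (bott_space R A).
Proof.
move=> bA; have [_ cov] := bott_covered (R := R) bA; split=> //.
- by move=> c [].
- by move=> c [_ + ->].
- apply: (@bott_map_smooth _ _ _ _ _ _ id) => //.
  apply/smooth_onP; first exact: openT.
  by move=> k j; exact: Ck_coord.
split=> [p q|].
  have [s <-] := bott_proj_surj p; have [t <-] := bott_proj_surj q => st.
  have [|r r0 rP] := orbit_separated (s := s) (t := t) bA.
    by move=> v E; apply: st; apply/(bott_projP _ _ bA); exists v.
  exists (bott_proj A @` (ball s r : set 'rV[R]_n)), (bott_proj A @` (ball t r : set 'rV[R]_n)); split.
  - exact/bott_atlas_open/ball_open.
  - exact/bott_atlas_open/ball_open.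
  - by exists s => //; exact: ballxx.
  - by exists t => //; exact: ballxx.
  - rewrite -subset0 => _ [[a + <-] [b + /esym/(bott_projP _ _ bA)[v bE]]].
    rewrite -!ball_normE /= => sa tb.
    have := rP v; rewrite leNgt => /negP; apply.
    rewrite -(subrKA (act A v a)); apply: le_lt_trans (ler_normD _ _) _.
    rewrite ltrD //; last by rewrite -bE distrC.
    exact: le_lt_trans (act_isometry _ _ _ _) sa.
(* Centres with coordinates in Z/4: rounding down leaves every point within 1/4 of a centre, inside
   the chart of radius 1/2. *)
pose ctr (m : 'rV[int]_n) : 'rV[R]_n := \row_j ((m 0 j)%:~R / 4).
exists [set (ball (ctr m) (2^-1 : R) : set 'rV[R]_n, bott_proj A) | m in [set: 'rV[int]_n]].
  by move=> _ [m _ <-]; split=> //=; [exact: ball_open|exact: bott_proj_inj_ball].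
split; first by apply: (card_le_trans (card_image_le _ _)); exact: countableP.
move=> p; have [t <-] := bott_proj_surj p.
pose m := \row_j Num.floor (4 * t 0 j).
exists (ball (ctr m) (2^-1 : R) : set 'rV[R]_n, bott_proj A); first by exists m.
exists t => //=; rewrite -ball_normE /= distrC.
apply: (@le_lt_trans _ _ (4^-1)); last by lra.
apply: normr_row_le => [|j]; first by rewrite invr_ge0.
rewrite !mxE; have := floor_le (4 * t 0 j); have := floorD1_gt (4 * t 0 j).
by rewrite rmorphD /= => h1 h2; rewrite ger0_norm; lra.
Qed.

(* Conjugation by the translation by [pi / 2] turns the reflection [t |-> - t]
   into [t |-> pi - t]. *)
Lemma half_period (x y : 'F_2) (T V : R) :
  sgF R y * T + pi * V + (nat_of_ord x)%:R * (pi / 2) =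
  sgF R y * (T + (nat_of_ord x)%:R * (pi / 2)) + pi * (V + (nat_of_ord (x * y)%R)%:R).
Proof.
have n0 : nat_of_ord (0 : 'F_2) = 0%N by [].
have n1 : nat_of_ord (1 : 'F_2) = 1%N by [].
by case: (F2_cases x) => ->; case: (F2_cases y) => ->;
  rewrite ?(mulr0, mul0r, mulr1) ?n0 ?n1 ?sgF0 ?sgF1; field.
Qed.

(** Row j of [Y] respects the characters up to the multiple e_j b_j. Removing it leaves [Qb], still
    invertible because it is [Y] multiplied by the unitriangular matrix [1 - E *m B^T], and [Qb]
    lifts to the integer matrix [P]. The removed multiples return as the translation by e_j pi/2. *)
Lemma eigen_iso1_diffeomorphic n m (A : 'M['F_2]_n) (B : 'M['F_2]_m) :
  bott_matrix A -> bott_matrix B -> eigen_iso1 A B ->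
  diffeomorphic (bott_space R A) (bott_space R B).
Proof.
move=> bA bB [Y [Z [YZ ZY hY]]].
have nm : m = n by apply/eqP; rewrite eqn_leq (mulmx1_min YZ) (mulmx1_min ZY).
subst m.
pose b j := chr B j *m Y; pose bm := B^T *m Y.
have bE j : b j = row j bm by rewrite row_mul; congr (_ *m _); apply/rowP => i; rewrite !mxE.
have [e eP] := choice hY.
pose E : 'M['F_2]_n := diag_mx (\row_j e j).
pose Qb := Y - E *m bm.
have EB j k : (1%:M - E *m B^T) j k = (j == k)%:R - e j * B k j.
  by rewrite mxE [(- _ : 'M[_]_(_, _)) _ _]mxE mul_diag_mx !mxE.
have QbE j k : Qb j k = Y j k - e j * b j 0 k.
  rewrite mxE [(- _ : 'M[_]_(_, _)) _ _]mxE mul_diag_mx mxE bE [row _ _ _ _]mxE.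
  by rewrite [(\row_(_ < _) _) _ _]mxE.
have Qu : Qb \in unitmx.
  have -> : Qb = (1%:M - E *m B^T) *m Y by rewrite mulmxBl mul1mx -mulmxA.
  rewrite unitmx_mul (mulmx1_unit YZ).1 andbT unitmxE det_trig.
    rewrite big1 ?unitr1 // => i _.
    by rewrite EB bB // mulr0 subr0 eqxx.
  apply/is_trig_mxP => i j ij; rewrite EB bB ?(ltnW ij) // mulr0 subr0.
  by rewrite (ltn_eqF ij : (i == j) = false).
have Qs j k : Qb j k != 0 -> b j = chr A k.
  move=> Qjk; apply/eqP; rewrite eq_sym; apply: contraNT Qjk => /eP.
  by rewrite mxE => H; rewrite QbE H subrr.
have [P [Pu Ps PE]] := unimodular_lift Qu Qs.
pose M : 'M[R]_n := (map_mx intr P)^T.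
pose M' : 'M[R]_n := (map_mx intr (invmx P))^T.
have MM' : M *m M' = 1%:M.
  by rewrite /M /M' -trmx_mul -map_mxM mulVmx // map_mx1 trmx1.
have M'M : M' *m M = 1%:M by exact: mulmx1C.
pose c : 'rV[R]_n := \row_j ((e j : nat)%:R * (pi / 2)).
pose h (t : 'rV[R]_n) := t *m M + c.
pose h' (t : 'rV[R]_n) := t *m M' + - (c *m M').
have hK : cancel h h' by move=> t; rewrite /h' /h mulmxDl -mulmxA MM' mulmx1 addrK.
have hK' : cancel h' h.
  by move=> t; rewrite /h' /h mulmxDl mulNmx -!mulmxA M'M !mulmx1 subrK.
pose tl (x : 'rV['F_2]_n) : 'rV[int]_n := \row_j Posz (nat_of_ord (e j * x ord0 j)%R).
(* The element of the deck group of [B] that [h] conjugates [v] into. Its second term is the shift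
   of [half_period] caused by the translation [c]. *)
pose f v := v *m P^T + tl (mod2 v *m bm^T).
have mod2tl (x : 'rV['F_2]_n) : mod2 (tl (x *m bm^T)) = x *m (E *m bm)^T.
  rewrite [(E *m bm)^T]trmx_mul mulmxA /E tr_diag_mx mul_mx_diag; apply/rowP => j.
  by rewrite mxE mxE F2_natK [RHS]mxE [(\row_(_ < _) _) _ _]mxE mulrC.
have mod2N (u : 'rV[int]_n) : mod2 (- u) = - mod2 u by rewrite /mod2 map_mxN.
have mod2f v : mod2 (f v) = mod2 v *m Y^T.
  rewrite mod2D (_ : mod2 (v *m P^T) = mod2 v *m Qb^T); last first.
    by rewrite /mod2 map_mxM -map_trmx PE.
  by rewrite mod2tl -mulmxDr -linearD /= subrK.
have hact v t : h (act A v t) = act B (f v) (h t).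
  apply/rowP => j; rewrite [RHS]mxE mod2f.
  have -> : (mod2 v *m Y^T *m B) 0 j = (mod2 v *m bm^T) 0 j.
    by rewrite /bm trmx_mul trmxK mulmxA.
  set be := (mod2 v *m bm^T) 0 j.
  have -> : h (act A v t) 0 j = sgF R be * (t *m M) 0 j + pi * ((v *m P^T) 0 j)%:~R + c 0 j.
    rewrite mxE; congr (_ + _); rewrite mxE.
    rewrite [(t *m M) 0 j]mxE [(v *m P^T) 0 j]mxE rmorph_sum /= !mulr_sumr -big_split /=.
    apply: eq_bigr => k _; rewrite [act _ _ _ _ _]mxE [M k j]mxE [map_mx _ _ _ _]mxE [P^T k j]mxE.
    have [->|/Ps Ejk] := eqVneq (P j k) 0; first by rewrite !(mulr0, mulr0z, addr0).
    have -> : (mod2 v *m A) 0 k = be.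
      rewrite /be !mxE; apply: eq_bigr => i _.
      by have /rowP/(_ i) := Ejk; rewrite bE [row _ _ _ _]mxE [chr _ _ _ _]mxE => <-; rewrite [bm^T _ _]mxE.
    by rewrite rmorphM /=; ring.
  by rewrite [h t 0 j]mxE [f v 0 j]mxE [tl _ 0 j]mxE [c 0 j]mxE rmorphD -/be; exact: half_period.
(* Mod 2, [f] is multiplication by [Y^T], so the parities [x] of the preimage are forced. They
   determine the correction term, and a linear equation in [P] remains. *)
have fS w : exists v, f v = w.
  pose x := mod2 w *m Z^T.
  pose v := (w - tl (x *m bm^T)) *m (invmx P)^T; exists v; rewrite /f.
  have vP : v *m P^T = w - tl (x *m bm^T).
    by rewrite /v -mulmxA -trmx_mul mulmxV // trmx1 mulmx1.
  suff -> : mod2 v = x by rewrite vP subrK.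
  have Qtu : Qb^T \in unitmx by rewrite unitmx_tr.
  apply: (can_inj (mulmxK Qtu)).
  have -> : mod2 v *m Qb^T = mod2 (w - tl (x *m bm^T)).
    by rewrite -vP [RHS]map_mxM -map_trmx PE.
  rewrite mod2D mod2N mod2tl linearB /= mulmxBr; congr (_ - _).
  by rewrite /x -mulmxA -trmx_mul YZ trmx1 mulmx1.
have sh : smooth_on setT h by apply: smooth_on_affine; exact: openT.
have sh' : smooth_on setT h' by apply: smooth_on_affine; exact: openT.
apply: (bott_diffeomorphic bA bB hK hK' sh sh').
  by move=> v t; exists (f v).
move=> w s; have [v <-] := fS w; exists v.
by rewrite -{1}(hK' s) -hact hK.
Qed.

End Manifold.

(** * Lifting to the universal cover *)

Section Box.
Context {R : realType} {n : nat}.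
Implicit Types a b t : 'rV[R]_n.

Definition box a b : set 'rV[R]_n := [set t | forall i, a 0 i <= t 0 i <= b 0 i].

(** The retraction onto the box. Composing with it makes a map that is continuous at the points of a
    box continuous everywhere, so lifts can be taken as globally continuous maps. *)
Definition clamp a b t : 'rV[R]_n := \row_i Num.min (b 0 i) (Num.max (a 0 i) (t 0 i)).

Definition upd a i (c : R) : 'rV[R]_n := \row_j (if j == i then c else a 0 j).

Lemma clamp_box a b t : (forall i, a 0 i <= b 0 i) -> box a b (clamp a b t).
Proof.
move=> ab i; rewrite mxE; apply/andP; split; last by rewrite ge_min lexx.
by rewrite le_min ab le_max lexx.
Qed.

Lemma clamp_id a b t : box a b t -> clamp a b t = t.
Proof.
move=> H; apply/rowP => i; rewrite mxE; have /andP[ai bi] := H i.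
by rewrite max_r // min_r.
Qed.

Lemma clamp_continuous a b : continuous (clamp a b).
Proof.
move=> t; apply: continuous_row => j.
rewrite (_ : (fun y => _) = fun y : 'rV[R]_n => Num.min (b 0 j) (Num.max (a 0 j) (y 0 j))); last first.
  by apply/funext => y; rewrite mxE.
apply: (@continuous_min _ _ (fun=> b 0 j) (fun y : 'rV[R]_n => Num.max (a 0 j) (y 0 j))).
  exact: cst_continuous.
apply: (@continuous_max _ _ (fun=> a 0 j) (fun y : 'rV[R]_n => y 0 j)).
  exact: cst_continuous.
exact: coord_continuous.
Qed.

Lemma box_compact a b : compact (box a b).
Proof.
rewrite (_ : box a b = [set t | forall i, `[a 0 i, b 0 i]%classic (t ord0 i)]).
  by apply: (@rV_compact R n (fun i => `[a 0 i, b 0 i]%classic)) => i; exact: segment_compact.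
by apply/seteqP; split=> t H i; have := H i; rewrite /= in_itv.
Qed.

Lemma box_convex a b t0 t (s : R) : box a b t0 -> box a b t -> 0 <= s <= 1 ->
  box a b (t0 + s *: (t - t0)).
Proof.
move=> H0 H1 /andP[s0 s1] i; rewrite !mxE.
have /andP[x1 x2] := H0 i; have /andP[y1 y2] := H1 i.
have s1' : 0 <= 1 - s by rewrite subr_ge0.
rewrite -subr_ge0 in x1; rewrite -subr_ge0 in x2; rewrite -subr_ge0 in y1; rewrite -subr_ge0 in y2.
have := mulr_ge0 s1' x1; have := mulr_ge0 s0 y1; have := mulr_ge0 s1' x2; have := mulr_ge0 s0 y2.
by move=> h1 h2 h3 h4; apply/andP; split; lra.
Qed.

End Box.

Section Lift.
Context {R : realType} {n m : nat} (B : 'M['F_2]_m).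
Hypothesis bB : bott_matrix B.

Lemma act_continuous v : continuous (act B v : 'rV[R]_m -> 'rV[R]_m).
Proof. by move=> x; exact: smooth_on_continuous (smooth_on_act _ _) _. Qed.

(* Along a segment the distance of [F2] to [act B w \o F1] takes no value
   in [0, 1[ except 0. *)
Lemma lift_unique (K : set 'rV[R]_n) (F1 F2 : 'rV[R]_n -> 'rV[R]_m) w t0 :
  (forall t1 t2 (s : R), K t1 -> K t2 -> 0 <= s <= 1 -> K (t1 + s *: (t2 - t1))) ->
  continuous F1 -> continuous F2 ->
  (forall t, K t -> bott_proj B (F1 t) = bott_proj B (F2 t)) ->
  K t0 -> F2 t0 = act B w (F1 t0) -> forall t, K t -> F2 t = act B w (F1 t).
Proof.
move=> cK c1 c2 F12 K0 E0 t Kt.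
pose d u := `|F2 u - act B w (F1 u)|.
have dP u : K u -> d u < 1 -> F2 u = act B w (F1 u).
  move=> Ku; have /(bott_projP _ _ bB)[w' E] := F12 u Ku.
  by rewrite /d E => /(act_discrete bB) ->.
apply: (dP t) => //; rewrite ltNge; apply/negP => d1.
pose p (s : R) := t0 + s *: (t - t0).
have cd : continuous (d \o p).
  move=> s; apply: continuous_comp.
    apply: continuousD; first exact: cst_continuous.
    exact: scalel_continuous.
  apply: (@continuous_comp _ _ _ (fun u => F2 u - act B w (F1 u)) Num.norm); last exact: norm_continuous.
  apply: continuousB; first exact: c2.
  by apply: (@continuous_comp _ _ _ F1 (act B w)); [exact: c1|exact: act_continuous].
have [||s sI] := @IVT R (d \o p) 0 1 (2^-1) ler01.
- exact: continuous_subspaceT.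
- rewrite /= /p scale0r addr0 scale1r subrKC {1 3}/d E0 subrr normr0.
  rewrite (min_l (le_trans ler01 d1)) (max_r (le_trans ler01 d1)) invr_ge0 ler0n /=.
  by apply: le_trans d1; lra.
move: sI; rewrite in_itv /= => sI ds.
have E : F2 (p s) = act B w (F1 (p s)).
  by apply: dP; [exact: cK|move: ds; rewrite /= => ->; lra].
by move: ds; rewrite /= /d E subrr normr0 => /esym/eqP; rewrite invr_eq0 pnatr_eq0.
Qed.

Variable h : 'rV[R]_n -> bott_quotient R B.

Definition liftable (K : set 'rV[R]_n) : Prop :=
  exists2 F : 'rV[R]_n -> 'rV[R]_m, continuous F & forall t, K t -> bott_proj B (F t) = h t.

(* Two lifts agreeing on the common face are glued by adding them and
   subtracting their common value there. *)
Lemma liftable_glue (a b : 'rV[R]_n) (i : 'I_n) (c : R) :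
  (forall j, a 0 j <= b 0 j) -> a 0 i <= c <= b 0 i ->
  liftable (box a (upd b i c)) -> liftable (box (upd a i c) b) -> liftable (box a b).
Proof.
set a' := upd a i c; set b' := upd b i c => ab /andP[ac cb] [F1 c1 l1] [F2 c2 l2].
have aE j : a' 0 j = if j == i then c else a 0 j by rewrite mxE.
have bE j : b' 0 j = if j == i then c else b 0 j by rewrite mxE.
have ab1 j : a 0 j <= b' 0 j by rewrite bE; case: eqP => [->|].
have ab2 j : a' 0 j <= b 0 j by rewrite aE; case: eqP => [->|].
have ab3 j : a' 0 j <= b' 0 j by rewrite aE bE; case: eqP.
have sub1 : box a' b' `<=` box a b'.
  move=> t H j; have /andP[h1 h2] := H j; rewrite h2 andbT; apply: le_trans h1.
  by rewrite aE; case: eqP => [->|].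
have sub2 : box a' b' `<=` box a' b.
  move=> t H j; have /andP[h1 h2] := H j; rewrite h1 /=; apply: le_trans h2 _.
  by rewrite bE; case: eqP => [->|].
have Ka : box a' b' a' by move=> j; rewrite lexx ab3.
have [w wP] : exists w, F2 a' = act B w (F1 a').
  by apply/(bott_projP _ _ bB); rewrite l1 ?l2 //; [exact: sub2|exact: sub1].
pose F1' t := act B w (F1 t).
have c1' : continuous F1'.
  by move=> t; apply: (@continuous_comp _ _ _ F1 (act B w)); [exact: c1|exact: act_continuous].
have l1' t : box a b' t -> bott_proj B (F1' t) = h t.
  by move=> /l1 <-; apply/esym/(bott_projP _ _ bB); exists w.
have face : forall t, box a' b' t -> F2 t = F1' t.
  apply: (lift_unique _ c1 c2 _ Ka wP) => [t1 t2 s|t Kt]; first exact: box_convex.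
  by rewrite l1 ?l2 //; [exact: sub2|exact: sub1].
(* On the lower box the last two clamps coincide and land on the common face, where [F2] equals
   [F1'], so those terms cancel. On the upper box the first and third terms cancel. *)
exists (fun t => F1' (clamp a b' t) + F2 (clamp a' b t) - F1' (clamp a' b' t)).
  have cc (G : 'rV[R]_n -> 'rV[R]_m) x y : continuous G -> continuous (fun t => G (clamp x y t)).
    by move=> cG t; apply: (@continuous_comp _ _ _ (clamp x y) G); [exact: clamp_continuous|exact: cG].
  by move=> t; exact: (cvgB (cvgD (cc F1' a b' c1' t) (cc F2 a' b c2 t)) (cc F1' a' b' c1' t)).
move=> t Kt; have [tc|ct] := leP (t 0 i) c.
  have Kt' : box a b' t.
    by move=> j; have /andP[h1 h2] := Kt j; rewrite h1 bE; case: eqP => [->|].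
  have -> : clamp a' b t = clamp a' b' t.
    apply/rowP => j; rewrite mxE [RHS]mxE aE bE; case: eqP => // ->.
    by rewrite max_l // minxx min_r.
  rewrite (face _ (clamp_box _ ab3)) (clamp_id Kt') addrK; exact: l1'.
have Kt' : box a' b t.
  by move=> j; have /andP[h1 h2] := Kt j; rewrite h2 aE; case: eqP => [->|_]; rewrite ?h1 ?(ltW ct).
have -> : clamp a b' t = clamp a' b' t.
  apply/rowP => j; rewrite mxE [RHS]mxE aE bE; case: eqP => // ->.
  by rewrite !min_l // le_max ?lexx ?(ltW ct) ?orbT.
by rewrite addrAC subrr add0r (clamp_id Kt'); exact: l2.
Qed.

Hypothesis h_local : forall t, exists (W : set 'rV[R]_n) (g : 'rV[R]_n -> 'rV[R]_m),
  [/\ open W, W t, forall u, W u -> {for u, continuous g} &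
      forall u, W u -> h u = bott_proj B (g u)].

Lemma liftable_subset K K' : K `<=` K' -> liftable K' -> liftable K.
Proof. by move=> KK' [F cF lF]; exists F => // t /KK'; exact: lF. Qed.

Lemma ball_box (x : 'rV[R]_n) (r : R) (t : 'rV[R]_n) : (forall i, `|x 0 i - t 0 i| <= r) ->
  box (x - const_mx r) (x + const_mx r) t.
Proof.
move=> H i; rewrite !mxE; have := H i; rewrite ler_norml => /andP[h1 h2].
by apply/andP; split; lra.
Qed.

Lemma liftable_near t : exists2 r : R, 0 < r & liftable (ball t r).
Proof.
have [W [g [oW Wt cg hg]]] := h_local t.
have /nbhs_ballP[r /= r0 rW] : nbhs t W by exact: open_nbhs_nbhs.
pose a : 'rV[R]_n := t - const_mx (r / 2); pose b : 'rV[R]_n := t + const_mx (r / 2).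
have r20 : 0 < r / 2 by rewrite divr_gt0.
have ab i : a 0 i <= b 0 i by rewrite !mxE lerD2l; lra.
have bW : box a b `<=` W.
  move=> u H; apply: rW; rewrite -ball_normE /=; apply: (@le_lt_trans _ _ (r / 2)); last by lra.
  apply: normr_row_le (ltW r20) _ => i; have := H i; rewrite !mxE => /andP[h1 h2].
  by rewrite ler_norml; apply/andP; split; lra.
exists (r / 2) => //; exists (fun u => g (clamp a b u)).
  move=> u; apply: (@continuous_comp _ _ _ (clamp a b) g); first exact: clamp_continuous.
  exact/cg/bW/clamp_box.
move=> u; rewrite -ball_normE /= => tu.
have Ku : box a b u.
  apply: ball_box => i; apply: le_trans (ltW tu).
  by apply: le_trans (normr_coord_le (t - u) i); rewrite !mxE.
by rewrite (clamp_id Ku) (hg u) //; exact: bW.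
Qed.

(** A Lebesgue number, by compactness of the box, for the balls of [liftable_near]. *)
Lemma liftable_uniformly (a b : 'rV[R]_n) :
  exists2 r : R, 0 < r & forall t, box a b t -> liftable (ball t r).
Proof.
have cov : near_covering (box a b) by apply/compact_near_coveringP; exact: box_compact.
have H : \forall r \near (0 : R)^'+, box a b `<=` (fun t => liftable (ball t r)).
  apply: (cov _ _ (fun r t => liftable (ball t r))) => t Kt.
  have [r r0 lr] := liftable_near t.
  exists (ball t (r / 2) : set 'rV[R]_n, [set s : R | s < r / 2]) => /=.
    split; first by apply: nbhsx_ballx; rewrite divr_gt0.
    by apply: nbhs_right_lt; rewrite divr_gt0.
  move=> [u s] /= [tu sr]; apply: liftable_subset lr => v uv.
  by rewrite (splitr r); apply: (ball_triangle tu); apply: le_ball uv; exact: ltW.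
have [r [r0 rP]] : exists r : R, 0 < r /\ (box a b `<=` (fun t => liftable (ball t r))).
  near (0 : R)^'+ => r; exists r; split; near: r; [exact: nbhs_right_gt|exact: H].
by exists r.
Unshelve. all: by end_near. Qed.

(* [N i] bounds how often side [i] has to be halved. *)
Lemma liftable_small_box (r : R) (a0 b0 : 'rV[R]_n) (N : 'I_n -> nat) (a b : 'rV[R]_n) : 0 < r ->
  (forall t, box a0 b0 t -> liftable (ball t (2 * r))) ->
  (forall i, a 0 i <= b 0 i) -> box a b `<=` box a0 b0 ->
  (forall i, b 0 i - a 0 i <= r * 2 ^+ N i) -> liftable (box a b).
Proof.
move=> r0 lr; move: {2}(\sum_i N i)%N (leqnn (\sum_i N i)%N) => S.
elim: S N a b => [|S IH] N a b.
  rewrite leqn0 sum_nat_eq0 => /forallP N0 ab Kab Hab.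
  (* All sides are now at most [r], so the box lies in the ball of radius [2 * r] around its corner
     [a]. *)
  apply: (liftable_subset _ (lr a _)); last by apply: Kab => i; rewrite lexx ab.
  move=> t Kt; rewrite -ball_normE /=; apply: (@le_lt_trans _ _ r); last by lra.
  apply: normr_row_le (ltW r0) _ => i; have /andP[h1 h2] := Kt i.
  have := Hab i; rewrite (eqP (N0 i)) expr0 mulr1 !mxE => h3.
  by rewrite ler_norml; apply/andP; split; lra.
have [/forallP N0 _|] := boolP [forall i, N i == 0%N].
  by apply: (IH N a b); rewrite big1 // => i _; exact/eqP.
rewrite negb_forall => /existsP[i Ni] NS ab Kab Hab.
pose c := (a 0 i + b 0 i) / 2.
have abi := ab i.
have ac : a 0 i <= c by rewrite /c; lra.
have cb : c <= b 0 i by rewrite /c; lra.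
pose N' j := if j == i then (N i).-1 else N j.
have N'S : (\sum_j N' j <= S)%N.
  move: NS; rewrite (bigD1 i) //= => NS; rewrite (bigD1 i) //= {1}/N' eqxx.
  rewrite (eq_bigr N) => [|j ji]; last by rewrite /N' (negPf ji).
  by case: (N i) Ni NS.
have NE : r * 2 ^+ N i = r * 2 ^+ (N i).-1 * 2.
  by case: (N i) Ni => // p _; rewrite exprSr mulrA.
apply: (liftable_glue (i := i) (c := c) ab); first by rewrite ac.
  apply: (IH N') => //.
  - by move=> j; rewrite mxE; case: eqP => [->|].
  - move=> t Kt; apply: Kab => j; have := Kt j; rewrite mxE.
    by case: eqP => [->|//] /andP[-> h2] /=; exact: le_trans cb.
  - move=> j; rewrite mxE /N'; case: eqP => [->|] //.
    by have := Hab i; rewrite NE /c; lra.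
apply: (IH N') => //.
- by move=> j; rewrite mxE; case: eqP => [->|].
- move=> t Kt; apply: Kab => j; have := Kt j; rewrite mxE.
  by case: eqP => [->|//] /andP[h1 ->]; rewrite andbT; exact: le_trans h1.
- move=> j; rewrite mxE /N'; case: eqP => [->|] //.
  by have := Hab i; rewrite NE /c; lra.
Qed.

Lemma liftable_box (a b : 'rV[R]_n) : (forall i, a 0 i <= b 0 i) -> liftable (box a b).
Proof.
move=> ab; have [r r0 lr] := liftable_uniformly a b.
have r20 : 0 < r / 2 by rewrite divr_gt0.
(* A crude count of halvings: [N i] already exceeds the side divided by [r / 2], and [2 ^ N i] is
   larger still. *)
pose N i := (Num.trunc ((b 0 i - a 0 i) / (r / 2))).+1.
apply: (@liftable_small_box (r / 2) a b N) => // [t Kt|i].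
  by rewrite mulrC divfK //; exact: lr.
rewrite mulrC -ler_pdivrMr //; apply: le_trans (_ : (N i)%:R <= _).
  by apply/ltW; rewrite /N; exact: truncnS_gt.
by rewrite -natrX ler_nat; exact/ltnW/ltn_expl.
Qed.

(** Lifts on the cubes [-N, N]^n, normalized by a deck transformation to take the same value at 0,
    agree on smaller cubes by [lift_unique], so they patch together. *)
Lemma global_lift : exists2 F : 'rV[R]_n -> 'rV[R]_m, continuous F &
  forall t, bott_proj B (F t) = h t.
Proof.
have [y0 y0E] := bott_proj_surj (h 0).
pose K (N : nat) : set 'rV[R]_n := box (const_mx (- N%:R)) (const_mx N%:R).
have KP N (t : 'rV[R]_n) : `|t| <= N%:R -> K N t.
  move=> tN i; rewrite !mxE -ler_norml; exact: le_trans (normr_coord_le _ _) tN.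
have K0 N : K N 0 by apply: KP; rewrite normr0.
have H N : {F : 'rV[R]_n -> 'rV[R]_m | [/\ continuous F,
    forall t, K N t -> bott_proj B (F t) = h t & F 0 = y0]}.
  apply: cid; have [|F cF lF] := @liftable_box (const_mx (- N%:R)) (const_mx N%:R).
    by move=> i; rewrite !mxE; have := ler0n R N; lra.
  have /(bott_projP _ _ bB)[w wP] : bott_proj B (F 0) = bott_proj B y0.
    by rewrite lF ?y0E //; exact: K0.
  exists (fun t => act B w (F t)); split=> //.
    by move=> t; apply: (@continuous_comp _ _ _ F (act B w)); [exact: cF|exact: act_continuous].
  by move=> t /lF <-; apply/esym/(bott_projP _ _ bB); exists w.
pose F N := sval (H N).
have KS N M : (N <= M)%N -> K N `<=` K M.
  move=> NM t Kt i; have := Kt i; rewrite !mxE => /andP[h1 h2].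
  have : (N%:R : R) <= M%:R by rewrite ler_nat.
  by move=> h3; apply/andP; split; lra.
have FF N M t : (N <= M)%N -> K N t -> F M t = F N t.
  move=> NM Kt; have [cN lN zN] := svalP (H N); have [cM lM zM] := svalP (H M).
  transitivity (act B 0 (F N t)); last by rewrite act0.
  apply: (lift_unique (K := K N) _ cN cM _ (K0 N) _ Kt).
  - by move=> t1 t2 s; exact: box_convex.
  - by move=> u Ku; rewrite lN // lM //; exact: KS Ku.
  - by rewrite act0 [LHS]zM [RHS]zN.
pose d (t : 'rV[R]_n) := (Num.trunc `|t|).+1.
have Kd t : K (d t) t by apply/KP/ltW; exact: truncnS_gt.
have FE N t : K N t -> F (d t) t = F N t.
  move=> Kt; have [NM|MN] := leqP N (d t); first exact: FF.
  by apply/esym/FF; [exact: ltnW|exact: Kd].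
exists (fun t => F (d t) t) => [t|t]; last first.
  by have [_ lN _] := svalP (H (d t)); exact: lN.
(* Points within 1 of [t] lie in the cube of half side [(d t).+1], where the patched map is this
   single continuous lift. *)
have [cM _ _] := svalP (H (d t).+1).
apply: (@near_continuous _ _ (F (d t).+1)); last exact: cM.
near=> u; apply/esym/FE/KP.
have ut : `|t - u| < 1 by near: u; exact: cvgr_dist_lt.
have : `|u| <= `|t| + `|t - u|.
  by rewrite -{1}(subKr t u); exact: ler_normB.
have : `|t| < (d t)%:R by exact: truncnS_gt.
by rewrite -[(d t).+1]addn1 natrD; lra.
Unshelve. all: by end_near. Qed.

End Lift.

(** * Unique decomposition *)

Section Rigidity.
Context {R : realType}.

Lemma global_lift_unique n m (B : 'M['F_2]_m) (F1 F2 : 'rV[R]_n -> 'rV[R]_m) :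
  bott_matrix B -> continuous F1 -> continuous F2 ->
  (forall t, bott_proj B (F1 t) = bott_proj B (F2 t)) ->
  exists w, forall t, F2 t = act B w (F1 t).
Proof.
move=> bB c1 c2 F12; have /(bott_projP _ _ bB)[w E] := F12 0.
by exists w => t; apply: (lift_unique bB (K := setT) _ c1 c2 _ _ E).
Qed.

Lemma bott_map_lift n m (A : 'M['F_2]_n) (B : 'M['F_2]_m)
    (f : bott_space R A -> bott_space R B) :
  bott_matrix A -> bott_matrix B -> smooth_map f ->
  exists2 F : 'rV[R]_n -> 'rV[R]_m, continuous F &
    forall t, bott_proj B (F t) = f (bott_proj A t).
Proof.
move=> bA bB sf; apply: global_lift => // t.
have [_ /(_ (f (bott_proj A t)))[e ae ef]] := bott_covered (R := R) bB.
have ac : atlas (bott_space R A) (ball t (2^-1 : R) : set 'rV[R]_n, bott_proj A).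
  by split=> //=; [exact: ball_open|exact: bott_proj_inj_ball].
have [||W [g [oW Wt _ sg gW]]] := sf _ e t ac ae; [exact: ballxx|exact: ef|].
exists W, g; split=> // u Wu; first exact: smooth_on_continuous sg _.
by have [_ ->] := gW u Wu; have [_ _ ->] := ae.
Qed.

(* The lift of a diffeomorphism conjugates one deck group to the other. *)
Lemma diffeomorphic_eigen_iso n m (A : 'M['F_2]_n) (B : 'M['F_2]_m) :
  bott_matrix A -> bott_matrix B ->
  diffeomorphic (bott_space R A) (bott_space R B) -> eigen_iso A B.
Proof.
move=> bA bB [f [g [fK gK sf sg]]].
have [F cF FE] := bott_map_lift bA bB sf.
have [G cG GE] := bott_map_lift bB bA sg.
(* Translating a lift by a deck transformation gives another lift of the same map, so uniqueness
   provides [phi]. It is multiplicative because the action is free. *)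
have deck p q (P : 'M['F_2]_p) (Q : 'M['F_2]_q) (h : bott_space R P -> bott_space R Q) H :
    bott_matrix P -> bott_matrix Q -> continuous H ->
    (forall t, bott_proj Q (H t) = h (bott_proj P t)) ->
    exists2 phi : 'rV[int]_p -> 'rV[int]_q,
      forall v t, H (act P v t) = act Q (phi v) (H t) &
      forall v w, phi (gmul P v w) = gmul Q (phi v) (phi w).
  move=> bP bQ cH HE.
  have /choice[phi phiE] v : exists w, forall t, H (act P v t) = act Q w (H t).
    apply: (global_lift_unique bQ cH (F2 := fun t => H (act P v t))).
      move=> t; apply: (@continuous_comp _ _ _ (act P v) H); [exact: act_continuous|exact: cH].
    by move=> t; rewrite !HE; congr h; apply/(bott_projP _ _ bP); exists v.
  exists phi => // v w; apply: (act_inj (t := H 0) bQ).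
  by rewrite -phiE -act_gmul !phiE act_gmul.
have [phi phiE phiM] := deck _ _ _ _ _ _ bA bB cF FE.
have [psi psiE psiM] := deck _ _ _ _ _ _ bB bA cG GE.
(* The composite of the two lifts covers the identity, so it is a deck transformation [u]. Hence
   [b (a v)] is the conjugate of [v] by [u], which has the same parities. *)
have inv p q (P : 'M['F_2]_p) (Q : 'M['F_2]_q) (H : 'rV[R]_p -> 'rV[R]_q) (H' : 'rV[R]_q -> 'rV[R]_p)
    (a : 'rV[int]_p -> 'rV[int]_q) (b : 'rV[int]_q -> 'rV[int]_p) :
    bott_matrix P -> continuous H -> continuous H' ->
    (forall t, bott_proj P (H' (H t)) = bott_proj P t) ->
    (forall v t, H (act P v t) = act Q (a v) (H t)) ->
    (forall v t, H' (act Q v t) = act P (b v) (H' t)) ->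
    forall v, mod2 (b (a v)) = mod2 v.
  move=> bP cH cH' HH aE bE v.
  have [||t|u uE] := @global_lift_unique p p P id (fun t => H' (H t)) bP.
  - by move=> t; exact: cvg_id.
  - by move=> t; apply: (@continuous_comp _ _ _ H H'); [exact: cH|exact: cH'].
  - by rewrite HH.
  have {}uE t : H' (H t) = act P u t := uE t.
  have : gmul P (b (a v)) u = gmul P u v.
    by apply: (act_inj (t := (0 : 'rV[R]_p)) bP); rewrite -!act_gmul -!uE -bE -aE.
  move/(congr1 (@mod2 _)); rewrite !mod2_gmul addrC => /addrI; exact.
apply: (eigen_iso_of_hom bA bB phiM psiM).
  by apply: (inv _ _ A B F G) => // t; rewrite GE FE fK.
by apply: (inv _ _ B A G F) => // t; rewrite FE GE gK.
Qed.

Lemma bott_real_bott_manifold n (A : 'M['F_2]_n) : bott_matrix A ->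
  real_bott_manifold (bott_space R A).
Proof.
move=> bA; have sm := bott_smooth_manifold (R := R) bA; split=> //; exists A => //.
by have [_ _ _ sid _] := sm; exists id, id.
Qed.

Lemma indecomposable_irreducible (X : atlas_space R) (A : 'M['F_2]_(Defs.dim X)) :
  indecomposable X -> bott_matrix A -> diffeomorphic X (bott_space R A) -> irreducible A.
Proof.
move=> [_ _ ndec] bA XA p pp pA.
have [|p0] := pselect (p = 0); first by left.
have [|p1] := pselect (p = 1%:M); first by right.
have [d [C [d0 bC hC]]] := reducible_split bA pp pA p0 p1.
case: ndec; exists 2%N, (fun i => bott_space R (C i)); split=> // [i|].
  by split; [exact: bott_real_bott_manifold|exact: d0].
have bD := bott_mxdiag bC.
apply: diffeomorphic_trans (bott_covered bA) XA _.
apply: diffeomorphic_trans (bott_covered bD) (eigen_iso1_diffeomorphic bA bD hC) _.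
exact: bott_mxdiag_diffeomorphic.
Qed.

End Rigidity.

Theorem theorem1p3 (R : realType) (k l : nat)
    (M : 'I_k -> atlas_space R) (N : 'I_l -> atlas_space R)
    (hM : forall i, indecomposable (M i))
    (hN : forall j, indecomposable (N j))
    (hMN : diffeomorphic (prod_space M) (prod_space N)) :
  exists (e : k = l) (sigma : {perm 'I_k}),
    forall i : 'I_k, diffeomorphic (M i) (N (cast_ord e (sigma i))).
Proof.
have pick (X : atlas_space R) : indecomposable X ->
    {A : 'M['F_2]_(Defs.dim X) | bott_matrix A /\ diffeomorphic X (bott_space R A)}.
  by move=> HX; apply: cid; case: HX => -[_ [A bA XA]] _ _; exists A.
have cov (X : atlas_space R) : indecomposable X -> covered X.
  by case=> -[/smooth_manifold_covered].
pose A i := sval (pick _ (hM i)); pose B j := sval (pick _ (hN j)).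
have bA i : bott_matrix (A i) by have [] := svalP (pick _ (hM i)).
have bB j : bott_matrix (B j) by have [] := svalP (pick _ (hN j)).
have MA i : diffeomorphic (M i) (bott_space R (A i)) by have [] := svalP (pick _ (hM i)).
have NB j : diffeomorphic (N j) (bott_space R (B j)) by have [] := svalP (pick _ (hN j)).
(* Each product is compared with the space of a block-diagonal matrix, to which the rigidity of deck
   groups applies. *)
have AB : eigen_iso (\mxdiag_i A i) (\mxdiag_j B j).
  apply: (diffeomorphic_eigen_iso (R := R)); [exact: bott_mxdiag|exact: bott_mxdiag|].
  apply: diffeomorphic_trans (bott_mxdiag_diffeomorphic bA) _.
    by apply: prod_covered => i; exact: bott_covered.
  apply: (@diffeomorphic_trans _ _ (prod_space M)); first by apply: prod_covered => i; exact: cov.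
    by apply: diffeomorphic_prod => i; exact: diffeomorphic_sym.
  apply: (@diffeomorphic_trans _ _ (prod_space N)) => //; first by apply: prod_covered => i; exact: cov.
  apply: (@diffeomorphic_trans _ _ (prod_space (fun j => bott_space R (B j)))).
  - by apply: prod_covered => j; exact: bott_covered.
  - exact: diffeomorphic_prod.
  - exact/diffeomorphic_sym/bott_mxdiag_diffeomorphic.
have [||||t tb tP] := krull_schmidt _ _ bA bB _ _ AB.
- by move=> i; have [] := hM i.
- by move=> j; have [] := hN j.
- by move=> i; exact: indecomposable_irreducible (hM i) (bA i) (MA i).
- by move=> j; exact: indecomposable_irreducible (hN j) (bB j) (NB j).
have e : k = l by rewrite -(card_ord k) -(card_ord l); exact: bij_eq_card tb.
have si : injective (fun i => cast_ord (esym e) (t i)).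
  by move=> i i' /cast_ord_inj; exact: bij_inj.
exists e, (perm si) => i; rewrite permE cast_ordKV.
apply: diffeomorphic_trans (bott_covered (bA i)) (MA i) _.
apply: diffeomorphic_trans (bott_covered (bB (t i))) _ (diffeomorphic_sym (NB (t i))).
exact: eigen_iso1_diffeomorphic.
Qed.
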